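(* Let $d\ge 0$ and $k\ge 0$ be fixed integers. As $b\to\infty$ through the integers $b\ge 2$, $b>d$, the quantity $I(b,d,k)-b\log(b)$ has an asymptotic expansion to all orders in inverse powers of $b$. The first occurring power of $b$ in it is $b^{-2k-1}$ if $d=0$ and $b^{-2k+1}$ if $d>0$. For $d>0$ and $k=0$, the term proportional to $b$ is $-b\log(1+\frac1d)$. In detail, with the implicit constants in the $O(b^{-n})$ depending on both $d$ and $k$: (i) $\displaystyle I(b,0,0)=b\log(b)+\frac{\zeta(2)}{2b}-\frac{\zeta(3)}{3b^2}+O(b^{-3})$. (ii) If $k>0$: $\displaystyle I(b,0,k)=b\log(b)+\frac{\zeta(2)}{2b^{2k+1}}+\frac{k\zeta(2)}{2b^{2k+2}}+O(b^{-2k-3})$. (iii) If $d>0$: $$I(b,d,0)=b\log(b)-b\log\Bigl(1+\frac1d\Bigr)+\frac{(d+\frac12)(\zeta(2)-d^{-2})}{b}-\frac{(d^2+d+\frac13)\zeta(3)-\frac{9d^2+8d+2}{6d^3(d+1)}}{b^2}+O(b^{-3}).$$ (iv) If $d>0$: $$I(b,d,1)=b\log(b)+\frac{d+\frac12}{d^2b}-\frac{9d^2+8d+2}{6d^3(d+1)b^2}+O(b^{-3}).$$ (v) If $d>0$ and $k>1$: $$I(b,d,k)=b\log(b)+\frac{d+\frac12}{d^2b^{2k-1}}+\frac{(d+\frac12)\bigl((k-2)d+k-3\bigr)}{d^2(d+1)b^{2k}}+O(b^{-2k-1}).$$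
   Context: For integers $b\ge 2$, $0\le d<b$ and $k\ge 0$, $I(b,d,k)=\sum \frac1m$, where the sum runs over all integers $m>0$ whose base-$b$ representation (without leading zeros) contains exactly $k$ occurrences of the digit $d$ (this series converges). $\zeta$ is the Riemann zeta function and $\log$ the natural logarithm. A function $f$ of the integer $b$ has an asymptotic expansion to all orders in inverse powers of $b$ if there are an integer $n_0$ (possibly negative) and coefficients $a_n$, $n\ge n_0$, independent of $b$ (but depending on $d$ and $k$), such that for every $N\ge n_0$, $f(b)=\sum_{n=n_0}^{N}a_nb^{-n}+O(b^{-N-1})$ as $b\to\infty$. *)

(* Defs.v *)
From HB Require Import structures.
From mathcomp Require Import all_boot all_order all_algebra.
From mathcomp Require Import all_classical all_reals all_analysis.

Set Implicit Arguments.
Unset Strict Implicit.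
Unset Printing Implicit Defensive.

Import Order.TTheory GRing.Theory Num.Theory.
Import numFieldNormedType.Exports.

Local Open Scope classical_set_scope.
Local Open Scope ring_scope.

(* Least significant digit first.  Meaningful for 1 < b and 0 < m only: then
   (trunc_log b m).+1 is the number of digits of m without leading zeros. *)
Definition digits (b m : nat) : seq nat :=
  [seq ((m %/ b ^ i) %% b)%N | i <- iota 0 (trunc_log b m).+1].

(* The sum is taken in the extended reals, where a series of nonnegative terms
   always has a value; as it is finite for 1 < b and d < b, [fine] loses
   nothing. *)
Definition irwin_sum (R : realType) (b d k : nat) : R :=
  fine (\sum_(0 <= m <oo | (0 < m)%N && (count_mem d (digits b m) == k))
          (m%:R^-1 : R)%:E)%E.

(* Only for real s > 1. *)
Definition zeta (R : realType) (s : R) : R := limn (series (riemannR s)).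

(* [f] has the asymptotic expansion \sum_(n >= n0) a n * b ^ (- n) as b tends
   to infinity.  Values of [a] below [n0] are irrelevant; so are the values of
   [f] at finitely many b, in particular where f b is not meaningful. *)
Definition asymptotic_expansion (R : realType) (f : nat -> R)
    (n0 : int) (a : int -> R) : Prop :=
  forall N : int, n0 <= N ->
    f = (fun b => \sum_(0 <= j < `|N - n0|%N.+1)
                    a (n0 + j%:Z) * b%:R ^ (- (n0 + j%:Z)))
        +O_\oo (fun b => b%:R ^ (- N - 1) : R).

(* b ^ (- p) is the first power occurring in the expansion (n0, a). *)
Definition first_exponent (R : realType) (n0 : int) (a : int -> R)
    (p : int) : Prop :=
  [/\ n0 <= p, a p != 0 & forall n : int, n0 <= n -> n < p -> a n = 0].

(* Main.v *)
Require Import Defs.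
From HB Require Import structures.
From mathcomp Require Import all_boot all_order all_algebra.
From mathcomp Require Import all_classical all_reals all_analysis.
From mathcomp Require Import ring lra zify.

Set Implicit Arguments.
Unset Strict Implicit.
Unset Printing Implicit Defensive.

Import Order.TTheory GRing.Theory Num.Theory.
Import numFieldNormedType.Exports.

Local Open Scope classical_set_scope.
Local Open Scope ring_scope.

(** Fix a base b, a digit d < b and write I_k for the sum of 1/m over the m
    whose expansion contains d exactly k times.  Let mu_k be the measure on
    [0, 1] with mass b^-l at the point 0.s, for every string s of l base-b
    digits (the empty string included) of which exactly k are equal to d.
    Reading off the first digit of s shows that mu_k is self-similar:

      int g dmu_k = [k = 0] g(0)
        + b^-1 \sum_(a < b, a <> d) int g((a + y)/b) dmu_k(y)
        + b^-1 int g((d + y)/b) dmu_(k-1)(y),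

    so that mu_k has total mass b.  Below, [irwin_mean b d k.+1 g] is
    b^-1 int g dmu_k, [irwin_mean b d 0 g] = 0 stands for k = -1, and
    [irwin_diff b d k g] = N_k(g) is the difference of the means of indices k
    and k + 1, that is b^-1 int g d(mu_(k-1) - mu_k).

    The integral U_k(n) of 1/(n + y) against mu_k is the sum of 1/m over the m
    whose expansion is n followed by a string containing d exactly k times.
    Hence I_k is a finite sum of values U_k(a) and U_(k-1)(d)
    ([irwin_sum_mean]), and self-similarity expresses U_k(n) through the values
    at b n + a, for a < b.  Since U_k(n) = b ln(1 + 1/n) + O(1/n^2), subtracting
    the logarithm, summing over n < X and letting X tend to infinity
    telescopes to the exact identity [irwin_sum_tail]:

      I_k / b - ln b = [d > 0] N_k(1/(d + y))
        + \sum_(n >= 1) ([k = 0]/(b n) + N_k(1/(b n + d + y))).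

    In the series, 1/(b n + d + y) is expanded in powers of 1/(b n); this gives
    zeta values times moments of N_k ([tail_main_bound]).  In the isolated
    term self-similarity is used once more, which replaces 1/(d + y) by the
    functions 1/(b d + a + y), again expanded in powers of y; this gives
    moments times the sums of (b d + a)^-(i+1) over a < b, together with the
    logarithm ln(1 + 1/d) when k = 0 ([head_main_bound]).

    It remains to expand the moments in powers of 1/b.  By self-similarity
    each of them solves an equation f = h + u f, where u = O(1/b) and h
    involves lower moments and smaller k only ([mean_moment_fix],
    [diff_moment_fix]).  Such an equation transfers expandability
    ([expandable_fix]) and estimates ([bigOinv_fix]) from h to f, whence
    the existence of the expansion ([normalized_excess_expandable]) and,
    through the leading behaviour of the first two moments
    ([mean_moment1_asymp], [mean_moment2_asymp], [diff_moment1_asymp],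
    [diff_moment_bigO2]), its explicit first terms. *)

(** * Self-similar means *)

Section IrwinMean.
Variable R : realType.
Variables b d : nat.

(** The part of [irwin_mean] coming from strings of fewer than L digits.  The
    index K is one more than the number of occurrences of d in the string, so
    that K = 0 asks for -1 occurrences and gives 0. *)
Fixpoint irwin_level (L K : nat) (g : R -> R) : R :=
  match L, K with
  | L'.+1, k.+1 =>
    b%:R^-1 * ((k == 0)%:R * g 0 +
      \sum_(a < b) irwin_level L' (if a == d :> nat then k else k.+1)
                     (fun y => g ((a%:R + y) / b%:R)))
  | _, _ => 0
  end.

Lemma irwin_level0K L g : irwin_level L 0 g = 0.
Proof. by case: L. Qed.

Lemma irwin_level_linear L K c (f g : R -> R) :
  irwin_level L K (fun y => c * f y + g y) =
  c * irwin_level L K f + irwin_level L K g.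
Proof.
elim: L K f g => [|L IH] [|k] f g /=; rewrite ?mulr0 ?addr0 //.
rewrite (eq_bigr _ (fun a _ => IH _ _ _)) big_split /= -mulr_sumr; ring.
Qed.

Lemma irwin_level_scale L K c (g : R -> R) :
  irwin_level L K (fun y => c * g y) = c * irwin_level L K g.
Proof.
have e0 : irwin_level L K (fun=> 0) = 0.
  have := irwin_level_linear L K (-1) (fun=> 0) (fun=> 0).
  by rewrite mulr0 addr0 mulN1r addNr.
rewrite -[RHS]addr0 -e0 -irwin_level_linear.
by congr irwin_level; apply/funext => y; rewrite addr0.
Qed.

Hypothesis b_gt1 : (1 < b)%N.
Hypothesis d_lt_b : (d < b)%N.

Let b_gt0 : (0 : R) < b%:R. Proof. by rewrite ltr0n ltnW. Qed.

Lemma shifted_digit_itv (a : 'I_b) (y : R) :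
  0 <= y <= 1 -> 0 <= (a%:R + y) / b%:R <= 1.
Proof.
move=> /andP[y0 y1]; rewrite divr_ge0 ?addr_ge0 ?ler0n //= ler_pdivrMr // mul1r.
apply: le_trans (_ : a%:R + 1 <= _); first by rewrite lerD2l.
by rewrite natr1 ler_nat.
Qed.

Lemma irwin_level_ge0 L K (g : R -> R) :
  (forall y, 0 <= y <= 1 -> 0 <= g y) -> 0 <= irwin_level L K g.
Proof.
elim: L K g => [|L IH] [|k] g g0 //=.
rewrite mulr_ge0 ?invr_ge0 ?ler0n // addr_ge0 //.
  by rewrite mulr_ge0 ?ler0n // g0 // lexx ler01.
apply: sumr_ge0 => a _; apply: IH => y y01; apply: g0.
exact: shifted_digit_itv.
Qed.

Lemma irwin_level_le L K (f g : R -> R) :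
  (forall y, 0 <= y <= 1 -> f y <= g y) ->
  irwin_level L K f <= irwin_level L K g.
Proof.
move=> fg; rewrite -subr_ge0.
have -> : irwin_level L K g - irwin_level L K f =
          irwin_level L K (fun y => -1 * f y + g y).
  by rewrite irwin_level_linear mulN1r addrC.
by apply: irwin_level_ge0 => y y01; rewrite mulN1r addrC subr_ge0 fg.
Qed.

(** The bound is preserved by the recursion because, among the b digits, only
    d lowers the index, and for K = 1 its branch vanishes and makes room for
    the empty string. *)
Lemma irwin_level_mass L K : irwin_level L K (fun=> 1) <= 1.
Proof.
elim: L K => [|L IH] [|k] /=; rewrite ?ler01 //.
rewrite mulr1 mulrC ler_pdivrMr // mul1r.
rewrite (bigD1 (Ordinal d_lt_b)) //= eqxx addrA.
apply: le_trans (_ : 1 + \sum_(i < b | i != Ordinal d_lt_b) 1 <= _).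
  apply: lerD; last by apply: ler_sum => i _; exact: IH.
  by case: k => [|k]; rewrite ?irwin_level0K ?addr0 ?add0r // mul0r.
rewrite sumr_const cardC1 card_ord -[1]/(1%:R) -natrD ler_nat; lia.
Qed.

Lemma irwin_level_nondecreasing K (g : R -> R) :
  (forall y, 0 <= y <= 1 -> 0 <= g y) ->
  nondecreasing_seq (fun L => irwin_level L K g).
Proof.
move=> g0; apply/nondecreasing_seqP => L.
elim: L K g g0 => [|L IH] [|k] g g0 //; first exact: irwin_level_ge0.
rewrite [leLHS]/= [leRHS]/= ler_wpM2l ?invr_ge0 ?ler0n // lerD2l.
apply: ler_sum => a _; apply: IH => y y01; apply: g0.
exact: shifted_digit_itv.
Qed.

(** Boundedness on the unit interval, which supports all the means. *)
Definition bounded01 (g : R -> R) :=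
  exists C, forall y, 0 <= y <= 1 -> `|g y| <= C.

(** The mean [b^-1 int g dmu_(K-1)]; meaningful for g bounded on [0, 1]. *)
Definition irwin_mean (K : nat) (g : R -> R) : R :=
  limn (fun L => irwin_level L K g).

Lemma irwin_level_bound L K (g : R -> R) C :
  (forall y, 0 <= y <= 1 -> `|g y| <= C) -> `|irwin_level L K g| <= C.
Proof.
move=> gC.
have C0 : 0 <= C by apply: le_trans (gC 0 _); rewrite ?lexx ?ler01.
have cst c : irwin_level L K (fun=> c) = c * irwin_level L K (fun=> 1).
  rewrite -irwin_level_scale; congr irwin_level.
  by apply/funext => y; rewrite mulr1.
have mass0 : 0 <= irwin_level L K (fun=> 1) by apply: irwin_level_ge0.
have := irwin_level_mass L K.
have /= h1 := @irwin_level_le L K g (fun=> C) (fun y y01 => ler_normlW (gC y y01)).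
have /= h2 := @irwin_level_le L K (fun=> - C) g.
have {}h2 : irwin_level L K (fun=> - C) <= irwin_level L K g.
  by apply: h2 => y /gC; rewrite ler_norml => /andP[].
move=> m1; rewrite (cst C) in h1; rewrite (cst (- C)) in h2.
by rewrite ler_norml; apply/andP; split; nra.
Qed.

Lemma irwin_mean_cvg K (g : R -> R) : bounded01 g ->
  (fun L => irwin_level L K g) @ \oo --> irwin_mean K g.
Proof.
move=> [C gC].
pose gp := fun y => 1 * g y + C; pose gc := fun _ : R => C.
have C0 : 0 <= C by apply: le_trans (gC 0 _); rewrite ?lexx ?ler01.
have cvg_nneg (h : R -> R) D : (forall y, 0 <= y <= 1 -> 0 <= h y) ->
    (forall y, 0 <= y <= 1 -> `|h y| <= D) -> cvgn ((fun L => irwin_level L K h)).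
  move=> h0 hD; apply: nondecreasing_is_cvgn; first exact: irwin_level_nondecreasing.
  by exists D => _ [L _ <-]; apply: ler_normlW; exact: irwin_level_bound.
have cp : cvgn (fun L => irwin_level L K gp).
  apply: (cvg_nneg _ (C + C)) => y /gC; rewrite /gp mul1r.
    by rewrite ler_norml => /andP[]; lra.
  by move=> gyC; rewrite (le_trans (ler_normD _ _)) // lerD // ger0_norm.
have cc : cvgn (fun L => irwin_level L K gc).
  by apply: (cvg_nneg _ C) => y _; rewrite /gc ?ger0_norm.
suff : cvgn (fun L => irwin_level L K g) by [].
have -> : (fun L => irwin_level L K g) =
    (fun L => irwin_level L K gp) \- (fun L => irwin_level L K gc).
  by apply/funext => L /=; rewrite /gp irwin_level_linear /gc; ring.
exact: is_cvgB.
Qed.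

Lemma irwin_mean0K g : irwin_mean 0 g = 0.
Proof.
rewrite /irwin_mean; under eq_fun do rewrite irwin_level0K; exact: lim_cst.
Qed.

Lemma bounded01_linear c (f g : R -> R) : bounded01 f -> bounded01 g ->
  bounded01 (fun y => c * f y + g y).
Proof.
move=> [C fC] [D gD]; exists (`|c| * C + D) => y y01.
rewrite (le_trans (ler_normD _ _)) // lerD ?gD //.
by rewrite normrM ler_wpM2l // fC.
Qed.

Lemma irwin_mean_linear K c (f g : R -> R) : bounded01 f -> bounded01 g ->
  irwin_mean K (fun y => c * f y + g y) =
  c * irwin_mean K f + irwin_mean K g.
Proof.
move=> bf bg; apply/cvg_lim => //.
under eq_fun do rewrite irwin_level_linear.
apply: cvgD; last exact: irwin_mean_cvg.
by apply: cvgMl_tmp; exact: irwin_mean_cvg.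
Qed.

Lemma irwin_mean_bound K (g : R -> R) C :
  (forall y, 0 <= y <= 1 -> `|g y| <= C) -> `|irwin_mean K g| <= C.
Proof.
move=> gC; have cv : cvgn ((fun L => irwin_level L K g)).
  by apply: cvgP; apply: irwin_mean_cvg; exists C.
rewrite ler_norml; apply/andP; split.
- apply: limr_ge => //; near=> L.
  by have := irwin_level_bound L K gC; rewrite ler_norml => /andP[].
- apply: limr_le => //; near=> L.
  by have := irwin_level_bound L K gC; rewrite ler_norml => /andP[].
Unshelve. all: by end_near. Qed.

End IrwinMean.

Section IrwinMeanRecursion.
Variable R : realType.
Variables b d : nat.
Hypothesis b_gt1 : (1 < b)%N.
Hypothesis d_lt_b : (d < b)%N.
Local Notation mean := (@irwin_mean R b d).
Let b_gt0 : (0 : R) < b%:R. Proof. by rewrite ltr0n ltnW. Qed.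

Let b_neq0 : (b%:R : R) != 0. Proof. by rewrite gt_eqF. Qed.

Lemma bounded01_cst (c : R) : bounded01 (fun=> c).
Proof. by exists `|c|. Qed.

Lemma bounded01_comp_digit (g : R -> R) (a : 'I_b) : bounded01 g ->
  bounded01 (fun y => g ((a%:R + y) / b%:R)).
Proof.
by move=> [C gC]; exists C => y y01; apply: gC; exact: (shifted_digit_itv b_gt1).
Qed.

Lemma bounded01_sum (n : nat) (c : nat -> R) (f : nat -> R -> R) :
  (forall i, bounded01 (f i)) -> bounded01 (fun y => \sum_(i < n) c i * f i y).
Proof.
move=> bf; elim: n => [|n IH].
  by under eq_fun do rewrite big_ord0; exact: bounded01_cst.
have -> : (fun y => \sum_(i < n.+1) c i * f i y) =
    (fun y => c n * f n y + \sum_(i < n) c i * f i y).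
  by apply/funext => y; rewrite big_ord_recr addrC.
exact: bounded01_linear.
Qed.

Lemma bounded01_exp (c : R) n : bounded01 (fun y => (c + y) ^+ n).
Proof.
exists ((`|c| + 1) ^+ n) => y /andP[y0 y1].
rewrite normrX lerXn2r ?nnegrE ?addr_ge0 // (le_trans (ler_normD _ _)) //.
by rewrite lerD2l ger0_norm.
Qed.

Lemma irwin_mean_sum K (n : nat) (c : nat -> R) (f : nat -> R -> R) :
  (forall i, bounded01 (f i)) ->
  mean K (fun y => \sum_(i < n) c i * f i y) = \sum_(i < n) c i * mean K (f i).
Proof.
move=> bf; elim: n => [|n IH].
  rewrite big_ord0; under eq_fun do rewrite big_ord0.
  have := irwin_mean_linear b_gt1 d_lt_b K (-1) (bounded01_cst 0) (bounded01_cst 0).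
  by rewrite mulr0 addr0 mulN1r addNr.
rewrite big_ord_recr /= addrC -IH -irwin_mean_linear //; last exact: bounded01_sum.
by congr (mean K _); apply/funext => y; rewrite big_ord_recr /= addrC.
Qed.

Lemma irwin_mean_rec k (g : R -> R) : bounded01 g ->
  mean k.+1 g = b%:R^-1 * ((k == 0)%:R * g 0 +
    \sum_(a < b) mean (if a == d :> nat then k else k.+1)
                      (fun y => g ((a%:R + y) / b%:R))).
Proof.
move=> bg.
have cv : (fun L => irwin_level b d L.+1 k.+1 g) @ \oo --> mean k.+1 g.
  by have := @irwin_mean_cvg R b d b_gt1 d_lt_b k.+1 g bg; rewrite -cvg_shiftS.
apply: (cvg_unique _ cv); first exact: norm_hausdorff.
apply: cvgMl_tmp; apply: cvgD; first exact: cvg_cst.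
apply: cvg_big => [|a _]; first exact: add_continuous.
apply: irwin_mean_cvg => //; exact: bounded01_comp_digit.
Qed.

(** The signed functional N_k, difference of two consecutive means. *)
Definition irwin_diff (k : nat) (g : R -> R) : R := mean k g - mean k.+1 g.

(** Self-similarity, with all digits treated alike and the correction due to
    the digit d collected in [irwin_diff]. *)
Lemma irwin_mean_recD k (g : R -> R) : bounded01 g ->
  mean k.+1 g = b%:R^-1 * ((k == 0)%:R * g 0 +
    \sum_(a < b) mean k.+1 (fun y => g ((a%:R + y) / b%:R))
    + irwin_diff k (fun y => g ((d%:R + y) / b%:R))).
Proof.
move=> /irwin_mean_rec ->; congr (_ * _); rewrite -addrA; congr (_ + _).
rewrite (bigD1 (Ordinal d_lt_b)) //= eqxx [in RHS](bigD1 (Ordinal d_lt_b)) //=.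
rewrite addrAC /irwin_diff subrKC; congr (_ + _).
apply: eq_bigr => a; rewrite -val_eqE /= => /negbTE -> //.
Qed.

(** At g = 1 self-similarity reads P_(k+1) = [k = 0] + P_k. *)
Lemma irwin_mean_mass k : mean k.+1 (fun=> 1) = 1.
Proof.
have rec k' : mean k'.+1 (fun=> 1) = (k' == 0)%:R + mean k' (fun=> 1).
  have := irwin_mean_recD k' (bounded01_cst 1).
  rewrite /= sumr_const card_ord mulr1 /irwin_diff => e.
  move: (e) => /(congr1 (fun x => b%:R * x)).
  rewrite mulrA mulfV // mul1r -mulr_natl => e'; lra.
by elim: k => [|k IH]; rewrite rec ?irwin_mean0K ?addr0 // IH add0r.
Qed.

Lemma irwin_diff_mass k : irwin_diff k (fun=> 1) = - (k == 0)%:R.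
Proof.
rewrite /irwin_diff irwin_mean_mass; case: k => [|k].
  by rewrite irwin_mean0K add0r.
by rewrite irwin_mean_mass subrr oppr0.
Qed.

Lemma irwin_diff_bound k (g : R -> R) C :
  (forall y, 0 <= y <= 1 -> `|g y| <= C) -> `|irwin_diff k g| <= 2 * C.
Proof.
move=> gC; rewrite (le_trans (ler_normB _ _)) // mulr_natl mulr2n.
by rewrite lerD // irwin_mean_bound.
Qed.

Lemma irwin_diff_linear k c (f g : R -> R) : bounded01 f -> bounded01 g ->
  irwin_diff k (fun y => c * f y + g y) =
  c * irwin_diff k f + irwin_diff k g.
Proof. by move=> bf bg; rewrite /irwin_diff !irwin_mean_linear //; ring. Qed.

Lemma irwin_diff_sum k (n : nat) (c : nat -> R) (f : nat -> R -> R) :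
  (forall i, bounded01 (f i)) ->
  irwin_diff k (fun y => \sum_(i < n) c i * f i y) =
  \sum_(i < n) c i * irwin_diff k (f i).
Proof.
move=> bf; rewrite /irwin_diff !irwin_mean_sum // -sumrB.
by apply: eq_bigr => i _; rewrite mulrBr.
Qed.

End IrwinMeanRecursion.

(** * Irwin sums as finite sums of means *)

Lemma sum_nat_blocks (V : nmodType) (f : nat -> V) (b A B : nat) :
  (A <= B)%N ->
  \sum_(A <= n < B) \sum_(a < b) f (b * n + a)%N =
  \sum_(b * A <= m < b * B) f m.
Proof.
move=> AB; rewrite -(subnKC AB); elim: (B - A)%N => [|n IH].
  by rewrite addn0 !big_geq.
rewrite addnS big_nat_recr ?leq_addr //= IH mulnS.
rewrite [in RHS](@big_cat_nat _ _ _ (b * (A + n))) /=; last 2 first.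
- by rewrite leq_mul2l leq_addr orbT.
- by rewrite leq_addl.
congr (_ + _); rewrite -[(b * (A + n))%N in RHS]add0n big_addn addnK.
by rewrite big_mkord; apply: eq_bigr => i _; rewrite addnC.
Qed.

Section IrwinDigits.
Variable R : realType.
Variables b d : nat.
Hypothesis b_gt1 : (1 < b)%N.
Hypothesis d_lt_b : (d < b)%N.
Let b_gt0 : (0 : R) < b%:R. Proof. by rewrite ltr0n ltnW. Qed.
Let b_neq0 : (b%:R : R) != 0. Proof. by rewrite gt_eqF. Qed.

Local Notation occ m := (count_mem d (digits b m)).

(** Digits are listed from the least significant one, so appending the digit
    a to the expansion of n adds a at the head of the list. *)
Lemma digits_cons n a : (0 < n)%N -> (a < b)%N ->
  digits b (b * n + a) = a :: digits b n.
Proof.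
move=> n0 ab; rewrite /digits.
have -> : trunc_log b (b * n + a) = (trunc_log b n).+1.
  apply: trunc_log_eq => //.
  have /andP[lo hi] := trunc_log_bounds b_gt1 n0.
  rewrite expnS (leq_trans _ (leq_addr _ _)) ?leq_mul2l ?lo ?orbT //=.
  rewrite expnS; apply: leq_trans (_ : b * n.+1 <= _)%N; last by rewrite leq_mul2l hi orbT.
  by rewrite mulnS addnC ltn_add2r.
rewrite -[iota 0 _]/(0%N :: iota (1 + 0) (trunc_log b n).+1) map_cons iotaDl.
rewrite -map_comp expn0 divn1 mulnC modnMDl modn_small //; congr (_ :: _).
apply: eq_map => i; rewrite [LHS]/=.
by rewrite add1n expnS divnMA divnMDl ?(ltnW b_gt1) // (divn_small ab) addn0.
Qed.

Lemma digits_small a : (0 < a)%N -> (a < b)%N -> digits b a = [:: a].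
Proof.
move=> a0 ab; rewrite /digits; have -> : trunc_log b a = 0%N.
  by apply: trunc_log_eq => //; rewrite expn0 expn1 a0.
by rewrite /= expn0 divn1 modn_small.
Qed.

Lemma inv_shifted_digit (n a : nat) (y : R) :
  (n%:R + (a%:R + y) / b%:R)^-1 = b%:R * ((b * n + a)%:R + y)^-1.
Proof.
have -> : n%:R + (a%:R + y) / b%:R = ((b * n + a)%:R + y) / b%:R.
  by rewrite natrD natrM; field.
by rewrite invfM invrK mulrC.
Qed.

(** The sum of 1/m over the m whose expansion is that of n followed by fewer
    than L digits, and contains d exactly K times.  The truncated subtraction
    gives index 0, hence the value 0, when n already has more than K
    occurrences of d. *)
Definition irwin_tree (L K n : nat) : R :=
  b%:R * irwin_level b d L (K.+1 - occ n) (fun y => (n%:R + y)^-1).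

Lemma irwin_tree_rec L K n : (0 < n)%N ->
  irwin_tree L.+1 K n =
  (occ n == K)%:R / n%:R + \sum_(a < b) irwin_tree L K (b * n + a).
Proof.
move=> n0; rewrite /irwin_tree.
have occE (a : 'I_b) : (K.+1 - occ (b * n + a))%N =
    (if a == d :> nat then (K.+1 - occ n).-1 else K.+1 - occ n)%N.
  rewrite digits_cons //=; case: eqP => _ /=; lia.
case E: (K.+1 - occ n)%N => [|j].
  rewrite irwin_level0K mulr0 big1; last first.
    by move=> a _; rewrite occE E if_same irwin_level0K mulr0.
  by rewrite addr0 (_ : (_ == _) = false) ?mul0r //; apply/eqP; lia.
rewrite [irwin_level _ _ L.+1 _ _]/= mulrA mulfV // mul1r addr0.
congr (_ + _).
  by congr (_%:R / _); congr nat_of_bool; apply/eqP/eqP; lia.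
apply: eq_bigr => a _; rewrite -irwin_level_scale occE E /=.
by congr irwin_level; apply/funext => y; rewrite inv_shifted_digit.
Qed.

Lemma irwin_tree_sum L K j :
  \sum_(b ^ j <= n < b ^ j.+1) irwin_tree L K n =
  \sum_(b ^ j <= m < b ^ (j + L)) (occ m == K)%:R / m%:R.
Proof.
elim: L j => [|L IH] j.
  rewrite addn0 [RHS]big_geq // big1 // => n _.
  by rewrite /irwin_tree /= mulr0.
have mono i l : (i <= l)%N -> (b ^ i <= b ^ l)%N by rewrite leq_exp2l.
rewrite big_nat_cond.
under eq_bigr => n /andP[/andP[nj _] _].
  rewrite irwin_tree_rec; last by rewrite (leq_trans _ nj) // expn_gt0 ltnW.
  over.
rewrite -big_nat_cond big_split /= sum_nat_blocks ?mono // -!expnS IH.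
rewrite -big_cat_nat ?addSnnS // mono //; lia.
Qed.

(** The Irwin sum, split according to the leading digit a. *)
Lemma irwin_sum_mean K :
  irwin_sum R b d K =
  \sum_(1 <= a < b) b%:R * irwin_mean b d (K.+1 - (a == d)) (fun y => (a%:R + y)^-1).
Proof.
set r := RHS; rewrite /irwin_sum.
pose P m := (0 < m)%N && (occ m == K).
pose S n := (\sum_(0 <= m < n | P m) (m%:R^-1 : R)%:E)%E.
have cvL : (fun L => \sum_(1 <= m < b ^ L) (occ m == K)%:R / m%:R) @ \oo --> r.
  have -> : (fun L => \sum_(1 <= m < b ^ L) (occ m == K)%:R / m%:R) =
            (fun L => \sum_(1 <= a < b) irwin_tree L K a).
    by apply/funext => L; have := irwin_tree_sum L K 0; rewrite expn0 expn1 add0n.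
  rewrite /r [in X in _ --> X]big_nat_cond.
  under eq_fun do rewrite big_nat_cond.
  apply: cvg_big => [|a /andP[/andP[a1 ab] _]]; first exact: add_continuous.
  rewrite /irwin_tree digits_small //= addn0; apply: cvgMl_tmp.
  apply: irwin_mean_cvg => //; exists 1 => y /andP[y0 y1].
  rewrite ger0_norm ?invr_ge0 ?addr_ge0 ?ler0n // invf_le1.
    by rewrite (le_trans (_ : 1 <= a%:R)) ?lerDl // ler1n.
  by rewrite ltr_pwDl // ltr0n.
have cvS : S @ \oo --> limn S.
  by apply: is_cvg_nneseries_cond => n _ _; rewrite lee_fin invr_ge0 ler0n.
(* The partial sums converge in the extended reals, so their limit is that
   of the subsequence of indices b ^ L. *)
have pow_oo : (fun L => b ^ L)%N @ \oo --> \oo.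
  apply/cvgnyPge => A; near=> L; apply: leq_trans (ltnW (ltn_expl L b_gt1)).
  by near: L; exists A.
have cvSb : S \o (fun L => b ^ L)%N @ \oo --> limn S by exact: (cvg_comp _ _ pow_oo cvS).
suff -> : limn S = r%:E by [].
apply: (cvg_unique _ cvSb); first exact: ereal_hausdorff.
have -> : S \o (fun L => b ^ L)%N =
    (fun L => (\sum_(1 <= m < b ^ L) (occ m == K)%:R / m%:R)%:E).
  apply/funext => L /=; rewrite /S sumEFin; congr EFin.
  rewrite (@big_ltn_cond _ _ _ 0) ?expn_gt0 ?(ltnW b_gt1) //= big_nat_cond [RHS]big_nat_cond.
  rewrite big_mkcond [RHS]big_mkcond; apply: eq_bigr => m _ /=.
  rewrite andbT /P; case: ifPn => [|]; case: (leqP 1 m) => //= m1.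
    by case: (m < _)%N => //=; case: eqP => //; rewrite mul1r.
  case: (m < _)%N => //=; case: eqP => // _; by rewrite mul0r.
by apply: cvg_EFin; [near=> L|exact: cvL].
Unshelve. all: by end_near. Qed.

End IrwinDigits.

(** * The exact identity for the Irwin sum *)

Section TailIdentity.
Variable R : realType.
Variables b d : nat.
Hypothesis b_gt1 : (1 < b)%N.
Hypothesis d_lt_b : (d < b)%N.
Local Notation mean := (@irwin_mean R b d).
Let b_gt0 : (0 : R) < b%:R. Proof. by rewrite ltr0n ltnW. Qed.
Let b_neq0 : (b%:R : R) != 0. Proof. by rewrite gt_eqF. Qed.

(** The kernel y |-> 1/(z + y). *)
Definition recip (z : R) : R -> R := fun y => (z + y)^-1.

Lemma bounded01_recip (z : R) : 0 < z -> bounded01 (recip z).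
Proof.
move=> z0; exists z^-1 => y /andP[y0 y1].
by rewrite ger0_norm ?invr_ge0 ?lef_pV2 ?posrE ?lerDl // ?addr_ge0 ?ltr_wpDr // ltW.
Qed.

Lemma irwin_mean_scale K c (g : R -> R) : bounded01 g ->
  mean K (fun y => c * g y) = c * mean K g.
Proof.
move=> bg; have := irwin_mean_sum b_gt1 d_lt_b K 1 (fun=> c) (f := fun=> g) (fun=> bg).
rewrite big_ord1 => <-; congr irwin_mean.
by apply/funext => y; rewrite big_ord1.
Qed.

Lemma irwin_diff_scale k c (g : R -> R) : bounded01 g ->
  irwin_diff b d k (fun y => c * g y) = c * irwin_diff b d k g.
Proof. by move=> bg; rewrite /irwin_diff !irwin_mean_scale // mulrBr. Qed.

Lemma recip_shifted (n a : nat) :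
  (fun y : R => recip n%:R ((a%:R + y) / b%:R)) =
  (fun y => b%:R * recip (b * n + a)%:R y).
Proof. by apply/funext => y; rewrite /recip (inv_shifted_digit b_gt1). Qed.

Lemma irwin_mean_recip_rec k n : (0 < n)%N ->
  mean k.+1 (recip n%:R) =
  \sum_(a < b) mean k.+1 (recip (b * n + a)%:R)
  + ((k == 0)%:R / (b%:R * n%:R) + irwin_diff b d k (recip (b * n + d)%:R)).
Proof.
move=> n0.
have pos a : (0 : R) < (b * n + a)%:R.
  by rewrite ltr0n addn_gt0 muln_gt0 n0 ltnW.
have bnd a := bounded01_recip (pos a).
rewrite (irwin_mean_recD b_gt1 d_lt_b); last by apply: bounded01_recip; rewrite ltr0n.
rewrite recip_shifted irwin_diff_scale; last exact: bnd.
have -> : \sum_(a < b) mean k.+1 (fun y => recip n%:R ((a%:R + y) / b%:R)) =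
    b%:R * \sum_(a < b) mean k.+1 (recip (b * n + a)%:R).
  rewrite mulr_sumr; apply: eq_bigr => a _.
  by rewrite recip_shifted irwin_mean_scale; last exact: bnd.
rewrite {1}/recip addr0 invfM -addrA mulrDr mulrA.
move: (\sum_(a < b) _) (irwin_diff _ _ _ _) => A B.
by field; rewrite b_neq0 pnatr_eq0 -lt0n n0.
Qed.

Lemma invn_diff_le (n : nat) : (0 < n)%N ->
  (n%:R : R)^-1 - (n.+1%:R)^-1 <= n%:R ^- 2.
Proof.
move=> n0; have n0R : (0 : R) < n%:R by rewrite ltr0n.
have -> : (n%:R : R)^-1 - n.+1%:R^-1 = n%:R^-1 * n.+1%:R^-1.
  by rewrite -natr1; field; rewrite gt_eqF //= gt_eqF // ltr_pwDr.
by rewrite -exprVn expr2 ler_pM2l ?invr_gt0 // lef_pV2 ?posrE ?ltr0n // ler_nat.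
Qed.

Lemma ln_succ_bounds (n : nat) : (0 < n)%N ->
  n.+1%:R^-1 <= ln n.+1%:R - ln (n%:R : R) <= n%:R^-1.
Proof.
move=> n0; have n0R : (0 : R) < n%:R by rewrite ltr0n.
rewrite -ln_div ?posrE ?ltr0n //; apply/andP; split; last first.
  have -> : n.+1%:R / n%:R = 1 + n%:R^-1 :> R.
    by rewrite -natr1; field; rewrite gt_eqF.
  by apply: le_ln1Dx; apply: (lt_trans (ltrN10 _)); rewrite invr_gt0.
rewrite -[leRHS]opprK -lnV ?posrE ?divr_gt0 ?ltr0n // invf_div lerNr.
have -> : n%:R / n.+1%:R = 1 + - n.+1%:R^-1 :> R.
  by rewrite -natr1; field; rewrite gt_eqF // ltr_pwDr.
by apply: le_ln1Dx; rewrite ltrNl opprK invf_lt1 ?ltr0n // ltr1n ltnS.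
Qed.

Lemma irwin_mean_ln_bound k (n : nat) : (0 < n)%N ->
  `|mean k.+1 (recip n%:R) - (ln n.+1%:R - ln n%:R)| <= 2 * n%:R ^- 2.
Proof.
move=> n0; have n0R : (0 : R) < n%:R by rewrite ltr0n.
have := ln_succ_bounds n0; have := invn_diff_le n0.
have : `|mean k.+1 (recip n%:R) - n%:R^-1| <= n%:R ^- 2.
  have <- : mean k.+1 (fun y => - n%:R^-1 * (fun=> 1) y + recip n%:R y) =
      mean k.+1 (recip n%:R) - n%:R^-1.
    rewrite (irwin_mean_linear b_gt1 d_lt_b) ?irwin_mean_mass //.
    - by rewrite mulr1 addrC.
    - exact: bounded01_cst.
    - exact: bounded01_recip.
  apply: irwin_mean_bound => // y /andP[y0 y1].
  apply: le_trans (invn_diff_le n0); rewrite mulr1 /recip.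
  have ny0 : 0 < n%:R + y by rewrite ltr_wpDr.
  have h1 : (n%:R + y)^-1 <= n%:R^-1 by rewrite lef_pV2 ?posrE // lerDl.
  have h2 : (n.+1%:R)^-1 <= (n%:R + y)^-1.
    by rewrite lef_pV2 ?posrE ?ltr0n // -natr1 lerD2l.
  move: h1 h2; move: (n%:R^-1) (n.+1%:R^-1) ((n%:R + y)^-1) => u v w h1 h2.
  by rewrite ler_norml; apply/andP; split; lra.
rewrite !ler_norml; move: (ln _ - _) (mean _ _) (n%:R^-1) (n.+1%:R^-1) (n%:R ^- 2).
move=> l m u v w /andP[h1 h2] h3 /andP[h4 h5].
by apply/andP; split; lra.
Qed.

(** By self-similarity F(n) = P_(k+1)(1/(n + y)) - ln(1 + 1/n) is the sum of
    F(b n + a) over a < b plus the n-th term of the series below.  Summing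
    over n < X, the partial sum of the series is the sum of F(m) over
    1 <= m < b, which is the claimed limit, minus the sum of F(m) over
    X <= m < b X, which is O(1/X). *)
Lemma irwin_sum_tail k :
  (fun X => \sum_(1 <= n < X) ((k == 0)%:R / (b%:R * n%:R) +
               irwin_diff b d k (recip (b * n + d)%:R))) @ \oo -->
  irwin_sum R b d k / b%:R - ln b%:R
    - (if (0 < d)%N then irwin_diff b d k (recip d%:R) else 0).
Proof.
pose F n := mean k.+1 (recip n%:R) - (ln n.+1%:R - ln n%:R).
pose E n := (k == 0)%:R / (b%:R * n%:R) + irwin_diff b d k (recip (b * n + d)%:R).
(* The logarithms telescope, on a range as well as on the b children of n. *)
have lnsum A B : (A <= B)%N ->
    \sum_(A <= n < B) (ln n.+1%:R - ln n%:R) = ln B%:R - ln A%:R :> R.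
  by move=> AB; rewrite telescope_sumr.
have Frec n : (0 < n)%N -> F n = \sum_(a < b) F (b * n + a)%N + E n.
  move=> n0; rewrite /F sumrB irwin_mean_recip_rec // -/(E n).
  have -> : \sum_(a < b) (ln (b * n + a).+1%:R - ln (b * n + a)%:R) =
      ln n.+1%:R - ln n%:R :> R.
    rewrite -(big_mkord xpredT (fun a => ln (b * n + a).+1%:R - ln (b * n + a)%:R)).
    have := lnsum (b * n)%N (b * n.+1)%N; rewrite leq_mul2l leqnSn orbT => /(_ isT).
    rewrite !natrM !lnM ?posrE ?ltr0n ?(ltnW b_gt1) // => e.
    transitivity (ln b%:R + ln n.+1%:R - (ln b%:R + ln n%:R) : R); last by ring.
    rewrite -e -[(b * n)%N in RHS]add0n big_addn mulnS addnK.
    by apply: eq_bigr => i _; rewrite addnC.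
  ring.
have c_eq : irwin_sum R b d k / b%:R - ln b%:R
    - (if (0 < d)%N then irwin_diff b d k (recip d%:R) else 0) =
    \sum_(1 <= m < b) F m.
  rewrite sumrB lnsum ?(ltnW b_gt1) // ln1 subr0 irwin_sum_mean // -mulr_sumr.
  rewrite mulrAC mulfV // mul1r addrAC; congr (_ - _).
  have neq (m : nat) : m != d -> mean (k.+1 - (m == d)) (fun y => (m%:R + y)^-1) =
      mean k.+1 (recip m%:R) by move=> /negbTE ->; rewrite subn0.
  case: (posnP d) => [d0|d0].
    rewrite subr0; apply: eq_big_nat => m /andP[m1 _].
    by rewrite neq // d0 -lt0n.
  rewrite (bigD1_seq d) /= ?mem_index_iota ?d0 ?iota_uniq //.
  rewrite [RHS](bigD1_seq d) /= ?mem_index_iota ?d0 ?iota_uniq //.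
  rewrite eqxx subSS subn0 (eq_bigr (fun m => mean k.+1 (recip m%:R))) //.
  rewrite /irwin_diff -/(recip d%:R); ring.
rewrite c_eq -/(E _); apply/cvgrPdist_le => e e0; near=> X.
have X0 : (0 < X)%N by near: X; exists 1%N.
have X0R : (0 : R) < X%:R by rewrite ltr0n.
have -> : \sum_(1 <= m < b) F m - \sum_(1 <= n < X) E n = \sum_(X <= m < b * X) F m.
  have e1 : \sum_(1 <= n < X) F n = \sum_(b <= m < b * X) F m + \sum_(1 <= n < X) E n.
    have := sum_nat_blocks F b X0; rewrite muln1 => <-; rewrite -big_split /=.
    by apply: eq_big_nat => n /andP[n0 _]; exact: Frec.
  have e2 : \sum_(1 <= n < X) F n + \sum_(X <= n < b * X) F n =
      \sum_(1 <= n < b) F n + \sum_(b <= n < b * X) F n.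
    rewrite -!big_cat_nat //= ?(ltnW b_gt1) ?leq_pmulr ?leq_pmull //.
    exact: ltnW.
  by move: e1 e2; lra.
apply: le_trans (_ : \sum_(X <= m < b * X) 2 * X%:R ^- 2 <= _).
  apply: le_trans (ler_norm_sum _ _ _) _; apply: ler_sum_nat => m /andP[Xm _].
  have m0 : (0 < m)%N by apply: leq_trans Xm.
  apply: le_trans (irwin_mean_ln_bound k m0) _.
  by rewrite ler_pM2l // -!exprVn lerXn2r ?nnegrE ?invr_ge0 ?ler0n // lef_pV2
    ?posrE ?ltr0n // ler_nat.
rewrite sumr_const_nat -[_ *+ (_ - _)]mulr_natr.
apply: le_trans (_ : 2 * X%:R ^- 2 * (b * X)%:R <= _).
  by rewrite ler_wpM2l ?mulr_ge0 ?invr_ge0 ?exprn_ge0 ?ler0n // ler_nat leq_subr.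
have -> : 2 * X%:R ^- 2 * (b * X)%:R = 2 * b%:R / X%:R :> R.
  by rewrite natrM; field; rewrite gt_eqF.
rewrite ler_pdivrMr // -ler_pdivrMl //.
by near: X; exact: nbhs_infty_ger.
Unshelve. all: by end_near. Qed.

End TailIdentity.

(** * Estimates and expansions in inverse powers *)

Section InversePowers.
Variable R : realType.
Variable b0 : nat.
Hypothesis b0_gt0 : (0 < b0)%N.

Implicit Types f g h u : nat -> R.

(** f(b) = O(b^-N), with a bound valid for all b >= b0. *)
Definition bigOinv (N : nat) f :=
  exists C : R, forall b, (b0 <= b)%N -> `|f b| <= C * b%:R^-1 ^+ N.

Let inv_ge0 b : (0 : R) <= b%:R^-1. Proof. by rewrite invr_ge0 ler0n. Qed.
Let inv_le1 b : (b0 <= b)%N -> (b%:R : R)^-1 <= 1.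
Proof.
move=> bb; have b1 : (0 < b)%N by apply: leq_trans bb.
by rewrite invf_le1 ?ltr0n // ler1n.
Qed.

Lemma eq_bigOinv N f g : (forall b, (b0 <= b)%N -> f b = g b) ->
  bigOinv N f -> bigOinv N g.
Proof. by move=> fg [C fC]; exists C => b bb; rewrite -fg // fC. Qed.

Lemma bigOinv_ge0 N f : bigOinv N f ->
  exists2 C : R, 0 <= C & forall b, (b0 <= b)%N -> `|f b| <= C * b%:R^-1 ^+ N.
Proof.
move=> [C fC]; exists `|C| => // b bb; apply: le_trans (fC b bb) _.
by rewrite ler_wpM2r ?exprn_ge0 // ler_norm.
Qed.

Lemma bigOinvD N f g : bigOinv N f -> bigOinv N g ->
  bigOinv N (fun b => f b + g b).
Proof.
move=> [C fC] [D gD]; exists (C + D) => b bb.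
by rewrite (le_trans (ler_normD _ _)) // mulrDl lerD ?fC ?gD.
Qed.

Lemma bigOinvM N M f g : bigOinv N f -> bigOinv M g ->
  bigOinv (N + M) (fun b => f b * g b).
Proof.
move=> [C fC] [D gD]; exists (C * D) => b bb.
by rewrite normrM exprD mulrACA ler_pM ?fC ?gD.
Qed.

Lemma bigOinvW N M f : (M <= N)%N -> bigOinv N f -> bigOinv M f.
Proof.
move=> MN /bigOinv_ge0[C C0 fC]; exists C => b bb.
apply: le_trans (fC b bb) _; rewrite ler_wpM2l //.
by rewrite ler_wiXn2l // inv_le1.
Qed.

Lemma bigOinv_cst (c : R) : bigOinv 0 (fun=> c).
Proof. by exists `|c| => b _; rewrite expr0 mulr1. Qed.

Lemma bigOinv_pow n : bigOinv n (fun b => b%:R^-1 ^+ n).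
Proof. by exists 1 => b _; rewrite mul1r ger0_norm // exprn_ge0. Qed.

Lemma bigOinvZ N c f : bigOinv N f -> bigOinv N (fun b => c * f b).
Proof. by move=> fN; have := bigOinvM (bigOinv_cst c) fN. Qed.

Lemma bigOinvN N f : bigOinv N f -> bigOinv N (fun b => - f b).
Proof. by move=> [C fC]; exists C => b bb; rewrite normrN fC. Qed.

Lemma bigOinvB N f g : bigOinv N f -> bigOinv N g ->
  bigOinv N (fun b => f b - g b).
Proof. by move=> fN /bigOinvN; exact: bigOinvD. Qed.

Lemma bigOinv0 N : bigOinv N (fun=> 0).
Proof. by exists 0 => b _; rewrite normr0 mul0r. Qed.

Lemma bigOinv_sum N (I : Type) (r : seq I) (P : pred I) (F : I -> nat -> R) :
  (forall i, P i -> bigOinv N (F i)) ->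
  bigOinv N (fun b => \sum_(i <- r | P i) F i b).
Proof.
move=> FN; elim: r => [|i r IH].
  by apply: (@eq_bigOinv N (fun=> 0)) (bigOinv0 N) => b _; rewrite big_nil.
case: (boolP (P i)) => Pi.
  apply: eq_bigOinv (bigOinvD (FN i Pi) IH) => b _.
  by rewrite big_cons Pi.
by apply: eq_bigOinv IH => b _; rewrite big_cons (negbTE Pi).
Qed.

(* a solution of f = h + u f, with u small, is as small as h *)
(** The bound on f improves by one power of 1/b at each use of the equation. *)
Lemma bigOinv_fix N f h u : bigOinv 0 f -> bigOinv 1 u -> bigOinv N h ->
  (forall b, (b0 <= b)%N -> f b = h b + u b * f b) -> bigOinv N f.
Proof.
move=> f0 u1 hN fE; suff : forall M, (M <= N)%N -> bigOinv M f by apply.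
elim=> [//|M IH] MN.
apply: (@eq_bigOinv _ (fun b => h b + u b * f b)) => [b bb|]; first by rewrite -fE.
apply: bigOinvD; first exact: bigOinvW hN.
by have := bigOinvM u1 (IH (ltnW MN)); rewrite add1n.
Qed.

(** f has an asymptotic expansion to all orders in inverse powers of b, the
    partial sums being given by polynomials in 1/b, which need not be
    truncations of one another.  This form is stable under all the operations
    needed; a single sequence of coefficients is extracted in
    [expandable_coefficients]. *)
Definition expandable f :=
  forall N, exists P : {poly R}, bigOinv N (fun b => f b - P.[b%:R^-1]).

Local Notation Exp := expandable.

Lemma eq_expandable f g : (forall b, (b0 <= b)%N -> f b = g b) -> Exp f -> Exp g.
Proof.
move=> fg fA N; have [P PN] := fA N; exists P.
by apply: eq_bigOinv PN => b bb; rewrite fg.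
Qed.

Lemma expandable_approx f :
  (forall N, exists2 g, Exp g & bigOinv N (fun b => f b - g b)) -> Exp f.
Proof.
move=> fA N; have [g gA fg] := fA N; have [P gP] := gA N; exists P.
by apply: eq_bigOinv (bigOinvD fg gP) => b _; rewrite addrA subrK.
Qed.

Lemma expandable_poly (P : {poly R}) : Exp (fun b => P.[b%:R^-1]).
Proof.
by move=> N; exists P; apply: eq_bigOinv (bigOinv0 N) => b _; rewrite subrr.
Qed.

Lemma expandable_cst c : Exp (fun=> c).
Proof. by apply: eq_expandable (expandable_poly c%:P) => b _; rewrite hornerC. Qed.

Lemma expandable_inv : Exp (fun b => b%:R^-1).
Proof. by apply: eq_expandable (expandable_poly 'X) => b _; rewrite hornerX. Qed.

Lemma bigOinv_poly (P : {poly R}) : bigOinv 0 (fun b => P.[b%:R^-1]).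
Proof.
apply: (@eq_bigOinv _ (fun b => \sum_(i < size P) P`_i * b%:R^-1 ^+ i)).
  by move=> b _; rewrite horner_coef.
by apply: bigOinv_sum => i _; apply: bigOinvZ; exact: bigOinvW (bigOinv_pow i).
Qed.

Lemma expandable_bounded f : Exp f -> bigOinv 0 f.
Proof.
move=> /(_ 0)[P fP]; apply: eq_bigOinv (bigOinvD fP (bigOinv_poly P)) => b _.
by rewrite subrK.
Qed.

Lemma expandable_D f g : Exp f -> Exp g -> Exp (fun b => f b + g b).
Proof.
move=> fA gA N; have [P fP] := fA N; have [Q gQ] := gA N; exists (P + Q).
by apply: eq_bigOinv (bigOinvD fP gQ) => b _; rewrite hornerD; ring.
Qed.

Lemma expandable_M f g : Exp f -> Exp g -> Exp (fun b => f b * g b).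
Proof.
move=> fA gA N; have [P fP] := fA N; have [Q gQ] := gA N; exists (P * Q).
apply: (@eq_bigOinv _ (fun b => (f b - P.[b%:R^-1]) * g b +
    P.[b%:R^-1] * (g b - Q.[b%:R^-1]))).
  by move=> b _; rewrite hornerM; ring.
apply: bigOinvD; last exact: (bigOinvM (bigOinv_poly P) gQ).
by have := bigOinvM fP (expandable_bounded gA); rewrite addn0.
Qed.

Lemma expandable_Z c f : Exp f -> Exp (fun b => c * f b).
Proof. by apply: expandable_M; exact: expandable_cst. Qed.

Lemma expandable_N f : Exp f -> Exp (fun b => - f b).
Proof. by move=> fA; apply: eq_expandable (expandable_Z (-1) fA) => b _; rewrite mulN1r. Qed.

Lemma expandable_B f g : Exp f -> Exp g -> Exp (fun b => f b - g b).
Proof. by move=> fA /expandable_N; exact: expandable_D. Qed.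

Lemma expandable_pow f n : Exp f -> Exp (fun b => f b ^+ n).
Proof.
move=> fA; elim: n => [|n IH]; first exact: expandable_cst.
by apply: eq_expandable (expandable_M fA IH) => b _; rewrite exprS.
Qed.

Lemma expandable_sum (I : Type) (r : seq I) (P : pred I) (F : I -> nat -> R) :
  (forall i, P i -> Exp (F i)) -> Exp (fun b => \sum_(i <- r | P i) F i b).
Proof.
move=> FA; elim: r => [|i r IH].
  by apply: eq_expandable (expandable_cst 0) => b _; rewrite big_nil.
case: (boolP (P i)) => Pi.
  by apply: eq_expandable (expandable_D (FA i Pi) IH) => b _; rewrite big_cons Pi.
by apply: eq_expandable IH => b _; rewrite big_cons (negbTE Pi).
Qed.

(** Iterating g |-> h + u g from 0 gives approximations of f of any order. *)
Lemma expandable_fix f h u : bigOinv 0 f -> bigOinv 1 u -> Exp h -> Exp u ->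
  (forall b, (b0 <= b)%N -> f b = h b + u b * f b) -> Exp f.
Proof.
move=> f0 u1 hA uA fE; apply: expandable_approx; elim=> [|N [g gA gN]].
  exists (fun=> 0); first exact: expandable_cst.
  by apply: eq_bigOinv f0 => b _; rewrite subr0.
exists (fun b => h b + u b * g b); first by apply: expandable_D => //; exact: expandable_M.
have := bigOinvM u1 gN; rewrite add1n; apply: eq_bigOinv => b bb.
by rewrite [in RHS]fE //; ring.
Qed.

End InversePowers.

(** * Power sums and inverse power sums *)

Section PowerSums.
Variable R : realType.
Variable b0 : nat.
Hypothesis b0_gt0 : (0 < b0)%N.
Local Notation Exp := (expandable b0).
Local Notation bigO := (bigOinv b0).

(** The power sum 0^i + ... + (b-1)^i divided by b^(i+1). *)
Definition power_sum (i b : nat) : R := b%:R^-1 ^+ i.+1 * \sum_(a < b) a%:R ^+ i.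

Lemma power_sum0 b : (0 < b)%N -> power_sum 0 b = 1.
Proof.
move=> b1; rewrite /power_sum expr1.
by rewrite sumr_const card_ord mulVf // pnatr_eq0 -lt0n.
Qed.

(** Faulhaber's recursion, from the telescoping sum of (a+1)^(j+1) - a^(j+1). *)
Lemma power_sum_rec j b : (0 < b)%N ->
  j.+1%:R * power_sum j b =
  1 - \sum_(i < j) 'C(j.+1, i)%:R * b%:R^-1 ^+ (j - i) * power_sum i b.
Proof.
move=> b1; have bN0 : (b%:R : R) != 0 by rewrite pnatr_eq0 -lt0n.
have tel : \sum_(i < j.+1) 'C(j.+1, i)%:R * \sum_(a < b) a%:R ^+ i = b%:R ^+ j.+1 :> R.
  transitivity (\sum_(0 <= a < b) (a.+1%:R ^+ j.+1 - a%:R ^+ j.+1) : R); last first.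
    by rewrite telescope_sumr // expr0n subr0.
  rewrite big_mkord; under eq_bigr do rewrite mulr_sumr.
  rewrite exchange_big; apply: eq_bigr => a _ /=.
  rewrite -nat1r exprDn [in RHS]big_ord_recr /= subnn expr0 mul1r binn mulr1n addrK.
  by apply: eq_bigr => i _; rewrite expr1n mul1r mulr_natl.
move: tel => /(congr1 (fun x => b%:R^-1 ^+ j.+1 * x)).
rewrite -exprMn mulVf // expr1n mulr_sumr big_ord_recr /= => tel.
rewrite binSn in tel; rewrite -[X in X - _]tel /power_sum.
rewrite [X in _ = _ - X](eq_bigr (fun i : 'I_j => b%:R^-1 ^+ j.+1 *
   ('C(j.+1, i)%:R * \sum_(a < b) a%:R ^+ i))); first by ring.
move=> i _; have -> : (j.+1 = (j - i) + i.+1)%N by rewrite addnS subnK // ltnW.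
by rewrite exprD; ring.
Qed.

Lemma power_sum1 b : (0 < b)%N -> power_sum 1 b = (1 - b%:R^-1) / 2.
Proof.
move=> b1; have := power_sum_rec 1 b1.
rewrite big_ord1 power_sum0 // bin0 expr1 => e; lra.
Qed.

Lemma power_sum_expandable j :
  Exp (power_sum j) /\ bigO 1 (fun b => power_sum j b - j.+1%:R^-1).
Proof.
elim/ltn_ind: j => j IH.
have jN0 : (j.+1%:R : R) != 0 by rewrite pnatr_eq0.
have eqn b : (b0 <= b)%N -> power_sum j b = j.+1%:R^-1 -
    j.+1%:R^-1 * \sum_(i < j) 'C(j.+1, i)%:R * b%:R^-1 ^+ (j - i) * power_sum i b.
  move=> bb; have := power_sum_rec j (leq_trans b0_gt0 bb).
  by move/(congr1 (fun x => j.+1%:R^-1 * x)); rewrite mulKf // => ->; ring.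
have term_expandable (i : 'I_j) :
    Exp (fun b => 'C(j.+1, i)%:R * b%:R^-1 ^+ (j - i) * power_sum i b).
  apply: (expandable_M b0_gt0); last by have [] := IH i (ltn_ord i).
  by apply: (expandable_Z b0_gt0); apply: (expandable_pow b0_gt0); exact: expandable_inv.
split.
  apply: (@eq_expandable _ _ (fun b => j.+1%:R^-1 - j.+1%:R^-1 *
     \sum_(i < j) 'C(j.+1, i)%:R * b%:R^-1 ^+ (j - i) * power_sum i b)).
    by move=> b bb; rewrite eqn.
  apply: (expandable_B b0_gt0); first exact: expandable_cst.
  by apply: (expandable_Z b0_gt0); apply: expandable_sum => i _; exact: term_expandable.
apply: (@eq_bigOinv _ _ _ (fun b => - j.+1%:R^-1 *
     \sum_(i < j) 'C(j.+1, i)%:R * b%:R^-1 ^+ (j - i) * power_sum i b)).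
  by move=> b bb; rewrite eqn // mulNr; ring.
apply: bigOinvZ; apply: bigOinv_sum => i _.
rewrite -[1%N]addn0; apply: bigOinvM.
  apply: bigOinvZ; apply: (bigOinvW b0_gt0 (N := j - i)); last exact: bigOinv_pow.
  by rewrite subn_gt0.
by apply: (expandable_bounded b0_gt0); have [] := IH i (ltn_ord i).
Qed.

End PowerSums.

Section InversePowerSums.
Variable R : realType.
Variables b0 d : nat.
Hypothesis b0_gt0 : (0 < b0)%N.
Hypothesis d_gt0 : (0 < d)%N.
Local Notation Exp := (expandable b0).
Local Notation bigO := (bigOinv b0).

(** 1 / (m^p (m+1) ... (m+j)).  For p = 1 these terms telescope, and
    [shifted_inverse_step] rewrites a term as one of smaller p plus one that
    is smaller by a power of m. *)
Definition shifted_inverse (p j m : nat) : R :=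
  m%:R^-1 ^+ p * \prod_(l < j) (m + l.+1)%:R^-1.

Lemma shifted_inverse_step p j m : (0 < m)%N ->
  shifted_inverse p.+1 j m =
  shifted_inverse p j.+1 m + j.+1%:R * shifted_inverse p.+1 j.+1 m.
Proof.
move=> m0; rewrite /shifted_inverse big_ord_recr /= exprS natrD.
have mN0 : (m%:R : R) != 0 by rewrite pnatr_eq0 -lt0n.
have mjN0 : (m%:R + j.+1%:R : R) != 0 by rewrite -natrD pnatr_eq0 addnS.
move: (_ ^+ p) (\prod_(_ < _) _) => A B; field; exact/andP.
Qed.

Lemma shifted_inverse_telescope j m : (0 < m)%N ->
  j.+1%:R * shifted_inverse 1 j.+1 m =
  \prod_(l < j.+1) (m + l)%:R^-1 - \prod_(l < j.+1) (m.+1 + l)%:R^-1.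
Proof.
move=> m0; rewrite /shifted_inverse big_ord_recr /= [X in X - _]big_ord_recl /=.
rewrite [X in _ - X]big_ord_recr /= addn0 expr1.
under [in RHS]eq_bigr do rewrite /bump add1n.
have -> : \prod_(i < j) ((m.+1 + i)%:R : R)^-1 = \prod_(l < j) (m + l.+1)%:R^-1.
  by apply: eq_bigr => l _; rewrite addSnnS.
have mN0 : (m%:R : R) != 0 by rewrite pnatr_eq0 -lt0n.
have mjN0 : (m%:R + j.+1%:R : R) != 0 by rewrite -natrD pnatr_eq0 addnS.
rewrite addSnnS natrD.
move: (\prod_(_ < _) _) => A; field; exact/andP.
Qed.

(** Sum of these terms over the block b d <= m < b d + b. *)
Definition shifted_inverse_sum (p j b : nat) : R :=
  \sum_(a < b) shifted_inverse p j (b * d + a).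

Lemma shifted_inverse_sum_bigO p j : bigO (p + j) (shifted_inverse_sum p.+1 j).
Proof.
exists 1 => b bb; have b1 : (0 < b)%N by apply: leq_trans bb.
have inv_le m : (b <= m)%N -> 0 <= (m%:R : R)^-1 <= b%:R^-1.
  move=> bm; rewrite invr_ge0 ler0n lef_pV2 ?posrE ?ltr0n ?ler_nat //.
  exact: leq_trans bm.
have le_m (a : nat) : (b <= b * d + a)%N.
  by rewrite (leq_trans _ (leq_addr _ _)) // leq_pmulr.
have term a : `|shifted_inverse p.+1 j (b * d + a)| <= b%:R^-1 ^+ (p.+1 + j).
  rewrite normrM exprD ler_pM // ?normrX.
    rewrite ger0_norm ?lerXn2r ?nnegrE ?invr_ge0 ?ler0n //.
    by have /andP[] := inv_le _ (le_m a).
  rewrite normr_prod; apply: le_trans (_ : \prod_(l < j) b%:R^-1 <= _).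
    apply: ler_prod => l _; rewrite normr_ge0 ger0_norm ?invr_ge0 ?ler0n //=.
    by have /andP[] := inv_le _ (leq_trans (le_m a) (leq_addr l.+1 _)).
  by rewrite prodr_const card_ord.
rewrite mul1r; apply: le_trans (ler_norm_sum _ _ _) _.
apply: le_trans (_ : \sum_(a < b) b%:R^-1 ^+ (p.+1 + j) <= _).
  by apply: ler_sum => a _; exact: term.
rewrite sumr_const card_ord addSn exprS -[X in X <= _]mulr_natl mulrA mulfV ?mul1r //.
by rewrite pnatr_eq0 -lt0n.
Qed.

Lemma inv_affine_expandable c l : (0 < c)%N -> Exp (fun b => (b * c + l)%:R^-1 : R).
Proof.
move=> c0; have cN0 : (c%:R : R) != 0 by rewrite pnatr_eq0 -lt0n.
apply: (@expandable_fix _ _ b0_gt0 _ (fun b => c%:R^-1 * b%:R^-1)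
         (fun b => - (l%:R / c%:R) * b%:R^-1)).
- exists 1 => b bb; have b1 : (0 < b)%N by apply: leq_trans bb.
  rewrite expr0 mulr1 ger0_norm ?invr_ge0 ?ler0n // invf_le1 ?ltr0n ?ler1n;
  by rewrite addn_gt0 muln_gt0 b1 c0.
- by apply: bigOinvZ; exact: (bigOinv_pow _ _ 1).
- by apply: (expandable_Z b0_gt0); exact: expandable_inv.
- by apply: (expandable_Z b0_gt0); exact: expandable_inv.
move=> b bb; have b1 : (0 < b)%N by apply: leq_trans bb.
have bN0 : (b%:R : R) != 0 by rewrite pnatr_eq0 -lt0n.
have : ((b * c + l)%:R : R) != 0 by rewrite pnatr_eq0 -lt0n addn_gt0 muln_gt0 b1 c0.
rewrite natrD natrM => N0; field; exact/and3P.
Qed.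

Lemma inv_affine_prod_expandable c j : (0 < c)%N ->
  Exp (fun b => \prod_(l < j) (b * c + l)%:R^-1 : R).
Proof.
move=> c0; elim: j => [|j IH].
  by apply: eq_expandable (expandable_cst _ 1) => b _; rewrite big_ord0.
apply: eq_expandable (expandable_M b0_gt0 IH (inv_affine_expandable j c0)) => b _.
by rewrite big_ord_recr.
Qed.

Lemma shifted_inverse_sum1 j b : (0 < b)%N ->
  shifted_inverse_sum 1 j.+1 b = j.+1%:R^-1 *
   (\prod_(l < j.+1) (b * d + l)%:R^-1 - \prod_(l < j.+1) (b * d.+1 + l)%:R^-1).
Proof.
move=> b1; have jN0 : (j.+1%:R : R) != 0 by rewrite pnatr_eq0.
apply: (canRL (mulKf jN0)); rewrite mulr_sumr.
pose h m : R := \prod_(l < j.+1) (m + l)%:R^-1.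
under eq_bigr => a _.
  rewrite shifted_inverse_telescope; last first.
    by rewrite addn_gt0 muln_gt0 b1 d_gt0.
  rewrite -/(h (b * d + a)%N) -/(h (b * d + a).+1).
  over.
rewrite -/(h (b * d)%N) -/(h (b * d.+1)%N).
have := telescope_sumr (fun a => - h (b * d + a)%N) (leq0n b).
rewrite big_mkord addn0 opprK addrC mulnS addnC => <-.
by apply: eq_bigr => a _; rewrite addnS opprK addrC.
Qed.

(** Outer induction on the number m of orders still missing, inner induction
    on p: in [shifted_inverse_step] the first term has smaller p and the second
    one is an order smaller. *)
Lemma shifted_inverse_sum_expandable p j : (1 <= p + j)%N -> Exp (shifted_inverse_sum p.+1 j).
Proof.
move=> pj N; move: pj; have [m] : exists m, (N <= p + j + m)%N.
  by exists N; rewrite leq_addl.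
elim: m p j => [|m IHm] p j.
  rewrite addn0 => Npj _; exists 0.
  apply: (@eq_bigOinv _ _ _ (shifted_inverse_sum p.+1 j)) => [b _|].
    by rewrite horner0 subr0.
  by apply: (bigOinvW b0_gt0 Npj); exact: shifted_inverse_sum_bigO.
elim: p j => [|p IHp] j Npj pj.
  case: j pj {Npj} => // j _; suff : Exp (shifted_inverse_sum 1 j.+1) by apply.
  apply: (@eq_expandable _ _ (fun b => j.+1%:R^-1 * (\prod_(l < j.+1) (b * d + l)%:R^-1
     - \prod_(l < j.+1) (b * d.+1 + l)%:R^-1))).
    by move=> b bb; rewrite shifted_inverse_sum1 // (leq_trans b0_gt0).
  by apply: (expandable_Z b0_gt0); apply: (expandable_B b0_gt0); exact: inv_affine_prod_expandable.
have [||P PN] := IHp j.+1; [lia|lia|].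
have [||Q QN] := IHm p.+1 j.+1; [lia|lia|].
exists (P + j.+1%:R *: Q).
apply: eq_bigOinv (bigOinvD PN (bigOinvZ j.+1%:R QN)) => b bb.
rewrite hornerD hornerZ.
have -> : shifted_inverse_sum p.+2 j b =
    shifted_inverse_sum p.+1 j.+1 b + j.+1%:R * shifted_inverse_sum p.+2 j.+1 b.
  rewrite /shifted_inverse_sum mulr_sumr -big_split /=; apply: eq_bigr => a _.
  apply: shifted_inverse_step.
  by rewrite addn_gt0 muln_gt0 d_gt0 (leq_trans b0_gt0 bb).
ring.
Qed.

(** The sum of m^-(i+1) over the block b d <= m < b d + b. *)
Definition inv_power_sum (i b : nat) : R :=
  \sum_(a < b) (b * d + a)%:R^-1 ^+ i.+1.

Lemma inv_power_sumE i : inv_power_sum i = shifted_inverse_sum i.+1 0.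
Proof.
apply/funext => b; apply: eq_bigr => a _.
by rewrite /shifted_inverse big_ord0 mulr1.
Qed.

Lemma inv_power_sum_expandable i : (0 < i)%N -> Exp (inv_power_sum i).
Proof.
by move=> i0; rewrite inv_power_sumE; apply: shifted_inverse_sum_expandable; rewrite addn0.
Qed.

Lemma inv_power_sum_bigO i : bigO i (inv_power_sum i).
Proof. by rewrite inv_power_sumE -[i in bigO i]addn0; exact: shifted_inverse_sum_bigO. Qed.

Lemma inv_power_sum1_bigO :
  bigO 2 (fun b => inv_power_sum 1 b - b%:R^-1 / (d%:R * (d%:R + 1))).
Proof.
apply: eq_bigOinv (shifted_inverse_sum_bigO 1 1) => b bb.
have b1 := leq_trans b0_gt0 bb.
have -> : inv_power_sum 1 b = shifted_inverse_sum 1 1 b + shifted_inverse_sum 2 1 b.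
  rewrite inv_power_sumE /shifted_inverse_sum -big_split /=; apply: eq_bigr => a _.
  rewrite shifted_inverse_step ?mul1r //.
  by rewrite addn_gt0 muln_gt0 d_gt0 b1.
rewrite shifted_inverse_sum1 // !big_ord1 !addn0 !natrM -natr1.
have bN0 : (b%:R : R) != 0 by rewrite pnatr_eq0 -lt0n.
have dN0 : (d%:R : R) != 0 by rewrite pnatr_eq0 -lt0n.
have d1N0 : (d%:R + 1 : R) != 0 by rewrite natr1 pnatr_eq0.
field; rewrite bN0 dN0 d1N0 //.
Qed.

End InversePowerSums.

(** * Moments of the means *)

Section Moments.
Variable R : realType.
Variable d : nat.
Local Notation Exp := (expandable (R := R) d.+2).
Local Notation bigO := (bigOinv (R := R) d.+2).
Let b0_gt0 : (0 < d.+2)%N. Proof. by []. Qed.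

Section FixedBase.
Variable b : nat.
Hypothesis b_gt1 : (1 < b)%N.
Hypothesis d_lt_b : (d < b)%N.
Let b_neq0 : (b%:R : R) != 0. Proof. by rewrite pnatr_eq0 -lt0n ltnW. Qed.

Lemma bounded01_pow j : bounded01 (fun y : R => y ^+ j).
Proof.
rewrite (_ : (fun y => y ^+ j) = fun y => (0 + y) ^+ j); first exact: bounded01_exp.
by apply/funext => y; rewrite add0r.
Qed.

Let binomial_fun (c : R) j : (fun y : R => (c + y) ^+ j) =
  (fun y => \sum_(i < j.+1) 'C(j, i)%:R * c ^+ (j - i) * y ^+ i).
Proof.
apply/funext => y; rewrite exprDn; apply: eq_bigr => i _.
by rewrite -mulr_natl mulrA.
Qed.

Lemma irwin_mean_shift K (c : R) j :
  irwin_mean b d K (fun y => (c + y) ^+ j) =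
  \sum_(i < j.+1) 'C(j, i)%:R * c ^+ (j - i) * irwin_mean b d K (fun y => y ^+ i).
Proof.
rewrite binomial_fun.
exact: (irwin_mean_sum b_gt1 d_lt_b K j.+1
  (fun i => 'C(j, i)%:R * c ^+ (j - i)) bounded01_pow).
Qed.

Lemma irwin_diff_shift k (c : R) j :
  irwin_diff b d k (fun y => (c + y) ^+ j) =
  \sum_(i < j.+1) 'C(j, i)%:R * c ^+ (j - i) * irwin_diff b d k (fun y => y ^+ i).
Proof.
rewrite /irwin_diff !irwin_mean_shift -sumrB.
by apply: eq_bigr => i _; rewrite mulrBr.
Qed.

Lemma irwin_mean_pow_rec k j :
  irwin_mean b d k.+1 (fun y : R => y ^+ j) =
  (k == 0)%:R * 0 ^+ j / b%:R +
  \sum_(i < j.+1) 'C(j, i)%:R * b%:R^-1 ^+ i * power_sum R (j - i) b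
                   * irwin_mean b d k.+1 (fun y => y ^+ i)
  + b%:R^-1 ^+ j.+1 * irwin_diff b d k (fun y => (d%:R + y) ^+ j).
Proof.
have scl (a : nat) : (fun y : R => ((a%:R + y) / b%:R) ^+ j) =
    (fun y => b%:R^-1 ^+ j * (a%:R + y) ^+ j).
  by apply/funext => y; rewrite exprMn mulrC.
rewrite (irwin_mean_recD b_gt1 d_lt_b); last exact: bounded01_pow.
rewrite scl (irwin_diff_scale b_gt1 d_lt_b); last exact: bounded01_exp.
under eq_bigr => a _.
  rewrite scl (irwin_mean_scale b_gt1 d_lt_b); last exact: bounded01_exp.
  rewrite irwin_mean_shift mulr_sumr.
  over.
rewrite exchange_big /= !mulrDr exprS mulrA; congr (_ + _ + _); [ring| |ring].
rewrite mulr_sumr; apply: eq_bigr => i _; rewrite /power_sum.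
rewrite -[X in _ = X]mulrA mulrC !mulr_sumr mulr_suml mulr_suml mulr_sumr.
apply: eq_bigr => a _.
have -> : b%:R^-1 ^+ j = b%:R^-1 ^+ i * b%:R^-1 ^+ (j - i) :> R.
  by rewrite -exprD subnKC // -ltnS.
rewrite exprS; ring.
Qed.

End FixedBase.

(** The moments of the means, as functions of the base. *)
Definition mean_moment (K j b : nat) : R := irwin_mean b d K (fun y => y ^+ j).
(** The moments of N_k. *)
Definition diff_moment (k j b : nat) : R := irwin_diff b d k (fun y => y ^+ j).
(** The values of N_k at the powers of d + y. *)
Definition diff_shifted_moment (k j b : nat) : R :=
  irwin_diff b d k (fun y => (d%:R + y) ^+ j).

Let ok b : (d.+2 <= b)%N -> (1 < b)%N /\ (d < b)%N.
Proof. by move=> ?; split; lia. Qed.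

Lemma diff_momentE k j b :
  diff_moment k j b = mean_moment k j b - mean_moment k.+1 j b.
Proof. by []. Qed.

Lemma mean_moment_bounded K j : bigO 0 (mean_moment K j).
Proof.
exists 1 => b /ok[b1 db]; rewrite expr0 mulr1.
apply: irwin_mean_bound => // y /andP[y0 y1].
by rewrite normrX ger0_norm // exprn_ile1.
Qed.

Lemma diff_moment_bounded k j : bigO 0 (diff_moment k j).
Proof. by apply: bigOinvB; exact: mean_moment_bounded. Qed.

Lemma mean_moment0 k b : (d.+2 <= b)%N -> mean_moment k.+1 0 b = 1.
Proof. by move=> /ok[b1 db]; exact: irwin_mean_mass. Qed.

Lemma diff_moment0 k b : (d.+2 <= b)%N -> diff_moment k 0 b = - (k == 0)%:R.
Proof. by move=> /ok[b1 db]; exact: irwin_diff_mass. Qed.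

Lemma diff_shifted_momentE k j b : (d.+2 <= b)%N ->
  diff_shifted_moment k j b =
  \sum_(i < j.+1) 'C(j, i)%:R * d%:R ^+ (j - i) * diff_moment k i b.
Proof. by move=> /ok[b1 db]; exact: irwin_diff_shift. Qed.

(** The inhomogeneous part of the equation satisfied by the j-th moment of
    [irwin_mean b d k.+1]: it involves moments of lower degree or lower
    index. *)
Definition mean_source (k j b : nat) : R :=
  (k == 0)%:R * 0 ^+ j / b%:R +
  \sum_(i < j) 'C(j, i)%:R * b%:R^-1 ^+ i * power_sum R (j - i) b
                   * mean_moment k.+1 i b
  + b%:R^-1 ^+ j.+1 *
    (\sum_(i < j.+1) 'C(j, i)%:R * d%:R ^+ (j - i) * mean_moment k i b
     - \sum_(i < j) 'C(j, i)%:R * d%:R ^+ (j - i) * mean_moment k.+1 i b).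

(** The coefficient of the unknown moment in its own equation. *)
Definition contraction (j b : nat) : R := b%:R^-1 ^+ j - b%:R^-1 ^+ j.+1.

Lemma mean_moment_fix k j b : (d.+2 <= b)%N ->
  mean_moment k.+1 j b =
  mean_source k j b + contraction j b * mean_moment k.+1 j b.
Proof.
move=> bb; have [b1 db] := ok bb.
have bN0 : (b%:R : R) != 0 by rewrite pnatr_eq0 -lt0n ltnW.
rewrite {1}/mean_moment (irwin_mean_pow_rec b1 db).
rewrite (irwin_diff_shift b1 db) /irwin_diff.
under [X in _ + _ * X]eq_bigr do rewrite mulrBr.
rewrite sumrB [X in _ + X + _]big_ord_recr [X in _ + _ * (_ - X)]big_ord_recr /=.
rewrite subnn binn power_sum0 ?(ltnW b1) // expr0 /mean_source /contraction.
rewrite /mean_moment; ring.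
Qed.

(** The analogue of [mean_source] for [irwin_diff b d k.+1]. *)
Definition diff_source (k j b : nat) : R :=
  (k == 0)%:R * 0 ^+ j / b%:R +
  \sum_(i < j) 'C(j, i)%:R * b%:R^-1 ^+ i * power_sum R (j - i) b
                   * diff_moment k.+1 i b
  + b%:R^-1 ^+ j.+1 *
    (\sum_(i < j.+1) 'C(j, i)%:R * d%:R ^+ (j - i) * diff_moment k i b
     - \sum_(i < j) 'C(j, i)%:R * d%:R ^+ (j - i) * diff_moment k.+1 i b).

Lemma diff_moment_fix k j b : (d.+2 <= b)%N ->
  diff_moment k.+1 j b =
  diff_source k j b + contraction j b * diff_moment k.+1 j b.
Proof.
move=> bb; rewrite [LHS]diff_momentE [X in X - _ = _]mean_moment_fix //.
rewrite [X in _ - X = _]mean_moment_fix //.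
rewrite /mean_source /diff_source /= !mul0r add0r.
under [X in _ = _ + X + _ + _]eq_bigr do rewrite diff_momentE mulrBr.
under [X in _ = _ + _ * (X - _) + _]eq_bigr do rewrite diff_momentE mulrBr.
under [X in _ = _ + _ * (_ - X) + _]eq_bigr do rewrite diff_momentE mulrBr.
rewrite !sumrB diff_momentE.
set S1 := \sum_(i < j) _ * mean_moment k.+1 i b.
ring.
Qed.

Lemma contraction_bigO j : (0 < j)%N -> bigO 1 (contraction j).
Proof.
by move=> j0; apply: bigOinvB; (apply: bigOinvW; last exact: bigOinv_pow).
Qed.

Lemma contraction_expandable j : Exp (contraction j).
Proof. by apply: expandable_B => //; apply: expandable_pow => //; exact: expandable_inv. Qed.

Lemma mean_moment_expandable K j : Exp (mean_moment K j).
Proof.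
elim: K j => [|k IHk] j.
  by apply: eq_expandable (expandable_cst _ 0) => b _; rewrite /mean_moment irwin_mean0K.
elim/ltn_ind: j => -[_|j IHj].
  by apply: eq_expandable (expandable_cst _ 1) => b bb; rewrite mean_moment0.
apply: (expandable_fix b0_gt0 (mean_moment_bounded _ _) (contraction_bigO (ltn0Sn j))
         (h := mean_source k j.+1)); last by move=> b; exact: mean_moment_fix.
- apply: expandable_D => //; first apply: expandable_D => //.
  + by apply: expandable_Z => //; exact: expandable_inv.
  + apply: expandable_sum => i _; apply: expandable_M => //; last exact: IHj.
    apply: expandable_M => //; last by have [] := power_sum_expandable R b0_gt0 (j.+1 - i).
    by apply: expandable_Z => //; apply: expandable_pow => //; exact: expandable_inv.
  + apply: expandable_M => //; first by apply: expandable_pow => //; exact: expandable_inv.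
    apply: expandable_B => //; apply: expandable_sum => i _; apply: expandable_Z => //.
    exact: IHj.
- exact: contraction_expandable.
Qed.

Lemma diff_moment_expandable k j : Exp (diff_moment k j).
Proof. by apply: expandable_B => //; exact: mean_moment_expandable. Qed.

Lemma diff_shifted_moment_expandable k j : Exp (diff_shifted_moment k j).
Proof.
apply: (@eq_expandable _ _ (fun b =>
  \sum_(i < j.+1) 'C(j, i)%:R * d%:R ^+ (j - i) * diff_moment k i b)).
  by move=> b bb; rewrite diff_shifted_momentE.
by apply: expandable_sum => i _; apply: expandable_Z => //; exact: diff_moment_expandable.
Qed.

End Moments.

(** * Estimates of the moments *)

Section MoreInversePowers.
Variable R : realType.
Variable b0 : nat.
Hypothesis b0_gt0 : (0 < b0)%N.
Local Notation bigO := (bigOinv (R := R) b0).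
Implicit Types f g h u : nat -> R.

(** Writes f as b^-N r with r bounded, so that estimates of algebraic
    expressions reduce to identities between rational functions. *)
Lemma bigOinv_factor N f : bigO N f ->
  exists2 r : nat -> R, bigO 0 r & forall b, (b0 <= b)%N -> f b = b%:R^-1 ^+ N * r b.
Proof.
move=> [C fC]; exists (fun b => b%:R ^+ N * f b).
  exists C => b bb; have b1 : (0 : R) < b%:R by rewrite ltr0n (leq_trans b0_gt0).
  rewrite expr0 mulr1 normrM ger0_norm ?exprn_ge0 ?ler0n //.
  by rewrite -ler_pdivlMl ?exprn_gt0 // mulrC -exprVn fC.
move=> b bb; have bN0 : (b%:R : R) != 0 by rewrite pnatr_eq0 -lt0n (leq_trans b0_gt0).
by rewrite mulrA -exprMn mulVf // expr1n mul1r.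
Qed.

Lemma bigOinv_scaled N r : bigO 0 r -> bigO N (fun b => b%:R^-1 ^+ N * r b).
Proof.
by move=> r0; have := bigOinvM (bigOinv_pow R b0 N) r0; rewrite addn0.
Qed.

Lemma bigOinv0M f g : bigO 0 f -> bigO 0 g -> bigO 0 (fun b => f b * g b).
Proof. by move=> f0 g0; have := bigOinvM f0 g0. Qed.

Lemma bigOinv0_inv : bigO 0 (fun b => b%:R^-1).
Proof. by apply: (bigOinvW b0_gt0 (N := 1)) => //; exact: (bigOinv_pow _ _ 1). Qed.

Lemma bigOinv0_pow n : bigO 0 (fun b => b%:R^-1 ^+ n).
Proof. by apply: (bigOinvW b0_gt0 (N := n)) => //; exact: bigOinv_pow. Qed.

(** To show that g approximates the solution f up to O(b^-N), it suffices that
    g solves the equation up to O(b^-N). *)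
Lemma bigOinv_fix_sub N f g h u : bigO 0 f -> bigO 0 g -> bigO 1 u ->
  (forall b, (b0 <= b)%N -> f b = h b + u b * f b) ->
  bigO N (fun b => h b + u b * g b - g b) -> bigO N (fun b => f b - g b).
Proof.
move=> f0 g0 u1 fE hN; apply: (bigOinv_fix b0_gt0 _ u1 hN).
  exact: bigOinvB.
by move=> b bb; rewrite {1}fE //; ring.
Qed.

End MoreInversePowers.

(** Proves that a polynomial expression in 1/b and bounded functions of b is
    bounded. *)
Ltac bigO_bounded := repeat first [assumption | exact: bigOinv_cst
  | match goal with H : forall _ : nat, bigOinv _ 0 _ |- _ => solve [apply: H] end
  | exact: bigOinv0_pow | exact: bigOinv0_inv
  | apply: bigOinv0M | apply: bigOinvD | apply: bigOinvB | apply: bigOinvN].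

Section MomentEstimates.
Variable R : realType.
Variable d : nat.
Local Notation Exp := (expandable (R := R) d.+2).
Local Notation bigO := (bigOinv (R := R) d.+2).
Let b0_gt0 : (0 < d.+2)%N. Proof. by []. Qed.
Local Notation mm := (mean_moment R d).
Local Notation dm := (diff_moment R d).

Lemma mean_moment0K j b : mm 0 j b = 0.
Proof. exact: irwin_mean0K. Qed.

Lemma mean_moment1_asymp :
  bigO 3 (fun b => mm 1 1 b - (1 / 2 - (d%:R + 1 / 2) * b%:R^-1 ^+ 2)).
Proof.
apply: (bigOinv_fix_sub b0_gt0 (mean_moment_bounded R d 1 1) _
  (contraction_bigO R d (ltn0Sn 0)) (@mean_moment_fix R d 0 1)).
  bigO_bounded.
(* b^-3 r(b) is what is left when the approximation is put in the equation. *)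
pose r b : R := (d%:R + 1 / 2) * (b%:R^-1 - 1).
apply: (@eq_bigOinv _ _ _ (fun b => b%:R^-1 ^+ 3 * r b)) => [b bb|]; last first.
  by apply: bigOinv_scaled; rewrite /r; bigO_bounded.
have bN0 : (b%:R : R) != 0 by rewrite pnatr_eq0 -lt0n (leq_trans b0_gt0 bb).
rewrite /mean_source /contraction !big_ord_recr !big_ord0 /= !mean_moment0K.
rewrite power_sum1 ?(leq_trans b0_gt0) // mean_moment0 // !bin0 expr0 /r; field; exact: bN0.
Qed.

Lemma mean_moment2_asymp : bigO 2 (fun b => mm 1 2 b - 1 / 3).
Proof.
apply: (bigOinv_fix_sub b0_gt0 (mean_moment_bounded R d 1 2) _
  (contraction_bigO R d (ltn0Sn 1)) (@mean_moment_fix R d 0 2)).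
  bigO_bounded.
have [r0 r0b r0E] := bigOinv_factor b0_gt0 mean_moment1_asymp.
pose e b : R := - (d%:R + 1 / 2) + b%:R^-1 * r0 b.
have mE b : (d.+2 <= b)%N -> mm 1 1 b = 1 / 2 + b%:R^-1 ^+ 2 * e b.
  by move=> /r0E; rewrite /e => e1; lra.
have eb : bigO 0 e by rewrite /e; bigO_bounded.
pose r b : R := 1/6 - 1/2 + b%:R^-1 * (1 - b%:R^-1) * e b
   - b%:R^-1 * (d%:R ^+ 2 + 2 * d%:R * (1 / 2 + b%:R^-1 ^+ 2 * e b))
   + (1 - b%:R^-1) / 3.
apply: (@eq_bigOinv _ _ _ (fun b => b%:R^-1 ^+ 2 * r b)) => [b bb|]; last first.
  by apply: bigOinv_scaled; rewrite /r; bigO_bounded.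
have b1 : (0 < b)%N by apply: leq_trans bb.
have s2 := power_sum_rec R 2 b1.
rewrite !big_ord_recr big_ord0 /= power_sum0 // power_sum1 // in s2.
have {}s2 : power_sum R 2 b = (1 - b%:R^-1 ^+ 2 - 3 * b%:R^-1 * ((1 - b%:R^-1) / 2)) / 3.
  move: s2; rewrite bin0 bin1 => s2; lra.
have bN0 : (b%:R : R) != 0 by rewrite pnatr_eq0 -lt0n (leq_trans b0_gt0 bb).
rewrite /mean_source /contraction !big_ord_recr !big_ord0 /= !mean_moment0K.
rewrite s2 power_sum1 // mean_moment0 // mE // !bin0 bin1 expr0 /r; field; exact: bN0.
Qed.

Lemma mean_moment_asymp j : bigO 1 (fun b => mm 1 j b - j.+1%:R^-1).
Proof.
case: j => [|j].
  apply: (@eq_bigOinv _ _ _ (fun=> 0)) => [b bb|]; last exact: bigOinv0.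
  by rewrite mean_moment0 // invr1 subrr.
apply: (bigOinv_fix_sub b0_gt0 (mean_moment_bounded R d 1 j.+1) _
  (contraction_bigO R d (ltn0Sn j)) (@mean_moment_fix R d 0 j.+1)).
  bigO_bounded.
have ps i : bigO 0 (power_sum R i).
  by apply: (expandable_bounded b0_gt0); have [] := power_sum_expandable R b0_gt0 i.
have mb i := mean_moment_bounded R d 1 i.
apply: (@eq_bigOinv _ _ _ (fun b => (power_sum R j.+1 b - j.+2%:R^-1)
  + contraction R j.+1 b * j.+2%:R^-1
  + (\sum_(i < j) 'C(j.+1, i.+1)%:R * b%:R^-1 ^+ i.+1 * power_sum R (j - i) b
                   * mm 1 i.+1 b)
  + b%:R^-1 ^+ j.+2 * (- \sum_(i < j.+1) 'C(j.+1, i)%:R * d%:R ^+ (j.+1 - i) * mm 1 i b))).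
  move=> b bb; rewrite /mean_source expr0n /= [X in _ = _ + X + _ * (_ - _) + _ - _]big_ord_recl /=.
  rewrite subn0 bin0 ?expr0 mean_moment0 //.
  rewrite [X in _ * (X - _)]big1; last by move=> i _; rewrite mean_moment0K mulr0.
  under [in RHS]eq_bigr do rewrite /bump leq0n add1n subSS.
  ring.
apply: bigOinvD; first apply: bigOinvD; first apply: bigOinvD.
- by have [] := power_sum_expandable R b0_gt0 j.+1.
- have := bigOinvM (contraction_bigO R d (ltn0Sn j)) (bigOinv_cst d.+2 (j.+2%:R^-1 : R)).
  by rewrite addn0.
- apply: bigOinv_sum => i _.
  apply: (@bigOinvW _ _ b0_gt0 i.+1) => //.
  apply: (@eq_bigOinv _ _ _ (fun b => b%:R^-1 ^+ i.+1 *
    ('C(j.+1, i.+1)%:R * power_sum R (j - i) b * mm 1 i.+1 b))).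
    by move=> b bb; ring.
  by apply: bigOinv_scaled; bigO_bounded.
- apply: (@bigOinvW _ _ b0_gt0 j.+2) => //; apply: bigOinv_scaled.
  by apply: bigOinvN; apply: bigOinv_sum => i _; bigO_bounded.
Qed.

End MomentEstimates.

Section DiffMoments.
Variable R : realType.
Variable d : nat.
Local Notation bigO := (bigOinv (R := R) d.+2).
Let b0_gt0 : (0 < d.+2)%N. Proof. by []. Qed.
Local Notation mm := (mean_moment R d).
Local Notation dm := (diff_moment R d).

(** Each increment of k gains a factor b^-2: the moments of index k enter the
    equation of those of index k + 1 with a factor b^-(j+1), and the moment of
    degree 0 vanishes.  For j >= 2 one more power is gained, because the term
    of degree i < j has a factor b^-i. *)
Lemma diff_moment_step k : (forall j, bigO (2 * k) (dm k j)) ->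
  forall j, bigO (2 * k + 2 + (1 < j)) (dm k.+1 j).
Proof.
move=> IHk; elim/ltn_ind => -[_|j IHj].
  apply: (@eq_bigOinv _ _ _ (fun=> 0)) => [b bb|]; last exact: bigOinv0.
  by rewrite diff_moment0 // oppr0.
apply: (bigOinv_fix b0_gt0 (diff_moment_bounded R d k.+1 j.+1)
  (contraction_bigO R d (ltn0Sn j)) (h := diff_source R d k j.+1)); last first.
  by move=> b; exact: diff_moment_fix.
have small i : (i < j.+1)%N -> bigO (2 * k + 2) (dm k.+1 i).
  by move=> ij; apply: (bigOinvW b0_gt0 _ (IHj i ij)); rewrite leq_addr.
have ps i : bigO 0 (power_sum R i).
  by apply: (expandable_bounded b0_gt0); have [] := power_sum_expandable R b0_gt0 i.
apply: (@eq_bigOinv _ _ _ (fun b =>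
  \sum_(i < j) b%:R^-1 ^+ i.+1 * dm k.+1 i.+1 b *
     ('C(j.+1, i.+1)%:R * power_sum R (j - i) b) +
  b%:R^-1 ^+ j.+2 * (
    \sum_(i < j.+2) 'C(j.+1, i)%:R * d%:R ^+ (j.+1 - i) * dm k i b -
    \sum_(i < j.+1) 'C(j.+1, i)%:R * d%:R ^+ (j.+1 - i) * dm k.+1 i b))).
  move=> b bb; rewrite /diff_source expr0n /= mulr0 mul0r add0r.
  rewrite [X in _ = X + _ * (_ - _)]big_ord_recl /= diff_moment0 // oppr0 mulr0 add0r.
  congr (_ + _); apply: eq_bigr => i _; rewrite /bump leq0n add1n subSS; ring.
apply: bigOinvD.
  apply: bigOinv_sum => i _.
  apply: (bigOinvW b0_gt0 (N := (i.+1 + (2 * k + 2)) + 0)); first by lia.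
  apply: bigOinvM; last by bigO_bounded.
  apply: bigOinvM; [exact: bigOinv_pow|apply: small].
  by rewrite ltnS.
apply: (bigOinvW b0_gt0 (N := j.+2 + 2 * k)); first by lia.
apply: bigOinvM; first exact: bigOinv_pow.
apply: bigOinvB; apply: bigOinv_sum => i _; apply: bigOinvZ; first exact: IHk.
by apply: (bigOinvW b0_gt0 _ (small i (ltn_ord i))); lia.
Qed.

Lemma diff_moment_bigO k j : bigO (2 * k) (dm k j).
Proof.
elim: k j => [|k IH] j; first exact: diff_moment_bounded.
by apply: (bigOinvW b0_gt0 _ (diff_moment_step IH j)); lia.
Qed.

Lemma diff_moment_bigO2 k j : (1 < j)%N -> bigO (2 * k + 3) (dm k.+1 j).
Proof.
move=> j1; have := diff_moment_step (diff_moment_bigO k) j.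
by rewrite j1 -addnA.
Qed.

Lemma diff_shifted_moment_bigO k j : bigO (2 * k) (diff_shifted_moment R d k j).
Proof.
apply: (@eq_bigOinv _ _ _ (fun b =>
  \sum_(i < j.+1) 'C(j, i)%:R * d%:R ^+ (j - i) * dm k i b)).
  by move=> b bb; rewrite diff_shifted_momentE.
by apply: bigOinv_sum => i _; apply: bigOinvZ; exact: diff_moment_bigO.
Qed.

Lemma diff_moment1_asymp k :
  bigO (2 * k + 4) (fun b => dm k.+1 1 b -
    (- (d%:R + 1 / 2) * b%:R^-1 ^+ (2 * k + 2) * (1 + k.+1%:R * b%:R^-1))).
Proof.
elim: k => [|k IH]; (apply: (bigOinv_fix_sub b0_gt0 (diff_moment_bounded R d _ _) _
  (contraction_bigO R d (ltn0Sn 0)) (@diff_moment_fix R d _ 1)); first by bigO_bounded).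
- have [r0 r0b r0E] := bigOinv_factor b0_gt0 (mean_moment1_asymp R d).
  pose r b : R := (d%:R + 1 / 2) * (1 + b%:R^-1) - b%:R^-1 * r0 b.
  apply: (@eq_bigOinv _ _ _ (fun b => b%:R^-1 ^+ 4 * r b)) => [b bb|]; last first.
    by apply: bigOinv_scaled; rewrite /r; bigO_bounded.
  have bN0 : (b%:R : R) != 0 by rewrite pnatr_eq0 -lt0n (leq_trans b0_gt0 bb).
  rewrite /diff_source /contraction !big_ord_recr !big_ord0 /= !diff_moment0 //.
  rewrite diff_momentE mean_moment0K.
  have -> : mm 1 1 b = (1 / 2 - (d%:R + 1 / 2) * b%:R^-1 ^+ 2) + b%:R^-1 ^+ 3 * r0 b.
    by rewrite -r0E //; ring.
  rewrite !bin0 bin1 /= /r; field; exact: bN0.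
have [r0 r0b r0E] := bigOinv_factor b0_gt0 IH.
pose r b : R := (d%:R + 1 / 2) * (1 - k.+2%:R + k.+2%:R * b%:R^-1) + r0 b.
have -> : (2 * k.+1 + 4 = (2 * k + 2) + 4)%N by lia.
apply: (@eq_bigOinv _ _ _ (fun b => b%:R^-1 ^+ (2 * k + 2 + 4) * r b)) => [b bb|];
    last first.
  by apply: bigOinv_scaled; rewrite /r; bigO_bounded.
have bN0 : (b%:R : R) != 0 by rewrite pnatr_eq0 -lt0n (leq_trans b0_gt0 bb).
rewrite /diff_source /contraction !big_ord_recr !big_ord0 /= !diff_moment0 //=.
have -> : dm k.+1 1 b = - (d%:R + 1 / 2) * b%:R^-1 ^+ (2 * k + 2) *
    (1 + k.+1%:R * b%:R^-1) + b%:R^-1 ^+ (2 * k + 4) * r0 b.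
  by rewrite -r0E //; ring.
have -> : (2 * k.+1 + 2 = (2 * k + 2) + 2)%N by lia.
have -> : (2 * k + 4 = (2 * k + 2) + 2)%N by lia.
rewrite !(exprD _ (2 * k + 2)) !bin0 bin1 /r.
move: (b%:R^-1 ^+ (2 * k + 2)) => B; rewrite -!natr1; field; exact: bN0.
Qed.

End DiffMoments.

(** * Expansion of reciprocals and logarithms *)

Section Expansions.
Variable R : realType.

Lemma inv_add_expand (z t : R) J : 0 < z -> 0 <= t ->
  `|(z + t)^-1 - \sum_(i < J) (-1) ^+ i * z^-1 ^+ i.+1 * t ^+ i|
  <= t ^+ J * z^-1 ^+ J.+1.
Proof.
move=> z0 t0; have zN0 : z != 0 by rewrite gt_eqF.
have zt0 : 0 < z + t by rewrite ltr_wpDr.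
have ztN0 : z + t != 0 by rewrite gt_eqF.
have -> : (z + t)^-1 - \sum_(i < J) (-1) ^+ i * z^-1 ^+ i.+1 * t ^+ i =
    (-1) ^+ J * z^-1 ^+ J * t ^+ J / (z + t).
  elim: J => [|J IH]; first by rewrite big_ord0 subr0 !expr0 !mul1r.
  rewrite big_ord_recr /= opprD addrA IH !exprS.
  move: ((-1) ^+ J) (z^-1 ^+ J) (t ^+ J) => A B C; field; exact/andP.
rewrite !normrM !normrX normrN1 expr1n mul1r normfV.
rewrite !ger0_norm ?invr_ge0 ?(ltW z0) ?(ltW zt0) //.
rewrite exprSr mulrA [X in _ <= X * _]mulrC.
rewrite ler_wpM2l ?mulr_ge0 ?exprn_ge0 ?invr_ge0 ?(ltW z0) //.
by rewrite lef_pV2 ?posrE // lerDl.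
Qed.

Lemma ln_expand (x : R) J : 0 < x ->
  `|ln (1 + x) - \sum_(i < J) (-1) ^+ i * x ^+ i.+1 / i.+1%:R| <= x ^+ J.+1.
Proof.
move=> x0.
pose f J (y : R) : R := ln (1 + y) - \sum_(i < J) (-1) ^+ i * y ^+ i.+1 / i.+1%:R.
pose df J (y : R) : R := (-1) ^+ J * y ^+ J / (1 + y).
have fD K (y : R) : 0 <= y -> is_derive y 1 (f K) (df K y).
  move=> y0; have y10 : 0 < 1 + y by rewrite ltr_wpDr.
  elim: K => [|K IH].
    have -> : f 0%N = (@ln R) \o (fun y => 1 + y).
      by apply/funext => w; rewrite /f /= big_ord0 subr0.
    rewrite /df !expr0 mul1r.
    have h2 : is_derive y 1 (fun w : R => 1 + w) 1.
      by apply: is_derive_eq; rewrite add0r mulr1.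
    have h1 := is_derive1_ln y10.
    by apply: (is_derive_eq (is_derive1_comp h1 h2)); rewrite mulr1 ?mul1r.
  have -> : f K.+1 = f K - ((-1) ^+ K / K.+1%:R) \*: (id ^+ K.+1).
    apply/funext => w; rewrite /f /= big_ord_recr /= opprD addrA.
    rewrite !fctE /GRing.scale /=; congr (_ - _); rewrite mulrAC; congr (_ * _).
  apply: (is_derive_eq (is_deriveB IH
    (is_deriveZ _ (is_deriveX K.+1 (is_derive_id y (1 : R)))))).
  have N0 : (K.+1%:R : R) != 0 by rewrite pnatr_eq0.
  have yN0 : 1 + y != 0 by rewrite gt_eqF.
  transitivity ((-1) ^+ K * y ^+ K / (1 + y)
      - (-1) ^+ K / K.+1%:R * (K.+1%:R * y ^+ K * 1)) => //.
  rewrite /df !exprS; move: ((-1) ^+ K) (y ^+ K) => A B; field; exact/andP.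
have [|||c /andP[c0 cx]] := @MVT R (f J) (df J) 0 x.
- by [].
- by move=> y; rewrite in_itv /= => /andP[/ltW y0 _]; exact: fD.
- apply: derivable_within_continuous => y; rewrite in_itv /= => /andP[y0 _].
  exact: (@ex_derive _ _ _ _ _ _ _ (fD J y y0)).
rewrite !bnd_simp in c0 cx.
have -> : f J 0 = 0.
  by rewrite /f addr0 ln1 sub0r big1 ?oppr0 // => i _; rewrite exprS mul0r mulr0 mul0r.
rewrite !subr0 -/(f J x) => ->.
rewrite exprSr normrM (gtr0_norm x0) ler_wpM2r ?(ltW x0) //.
rewrite /df !normrM normfV !normrX normrN1 expr1n mul1r.
have c1 : 0 < 1 + c by rewrite ltr_wpDr // ltW.
rewrite (gtr0_norm c0) (gtr0_norm c1) ler_pdivrMr //.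
apply: le_trans (_ : x ^+ J * 1 <= _).
  by rewrite mulr1 lerXn2r ?nnegrE ?(ltW c0) ?(ltW x0) // ltW.
by rewrite ler_wpM2l ?exprn_ge0 ?(ltW x0) // lerDl ltW.
Qed.

Lemma ln_succ_expand n J : (0 < n)%N ->
  `|(ln n.+1%:R - ln n%:R) -
    \sum_(i < J) (-1) ^+ i * n%:R^-1 ^+ i.+1 / i.+1%:R| <= n%:R^-1 ^+ J.+1 :> R.
Proof.
move=> n0; have n0R : (0 : R) < n%:R by rewrite ltr0n.
have := @ln_expand n%:R^-1 J; rewrite invr_gt0 => /(_ n0R).
have -> : 1 + n%:R^-1 = n.+1%:R / n%:R :> R.
  by rewrite -natr1; field; rewrite gt_eqF.
by rewrite ln_div // posrE ltr0n.
Qed.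

Section FixedBase.
Variables b d : nat.
Hypothesis b_gt1 : (1 < b)%N.
Hypothesis d_lt_b : (d < b)%N.

Lemma irwin_diff_recip_expand k (z e : R) J : 0 < z -> 0 <= e ->
  `|irwin_diff b d k (recip (z + e)) -
    \sum_(i < J) (-1) ^+ i * z^-1 ^+ i.+1 * irwin_diff b d k (fun y => (e + y) ^+ i)|
  <= 2 * ((e + 1) ^+ J * z^-1 ^+ J.+1).
Proof.
move=> z0 e0.
have be i : bounded01 (fun y : R => (e + y) ^+ i) by exact: bounded01_exp.
rewrite -(irwin_diff_sum b_gt1 d_lt_b k J (fun i => (-1) ^+ i * z^-1 ^+ i.+1) be).
pose s y := \sum_(i < J) (-1) ^+ i * z^-1 ^+ i.+1 * (e + y) ^+ i.
have bs : bounded01 s := bounded01_sum J (fun i => (-1) ^+ i * z^-1 ^+ i.+1) be.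
rewrite -/s addrC -mulN1r -(irwin_diff_linear b_gt1 d_lt_b) //; last first.
  by apply: bounded01_recip; rewrite ltr_wpDr.
apply: irwin_diff_bound => // y /andP[y0 y1].
have ey0 : 0 <= e + y by rewrite addr_ge0.
rewrite mulN1r addrC /recip -addrA.
apply: le_trans (inv_add_expand J z0 ey0) _.
rewrite ler_wpM2r ?exprn_ge0 ?invr_ge0 ?(ltW z0) //.
by rewrite lerXn2r ?nnegrE ?addr_ge0 // lerD2l.
Qed.

(** N_(k-1), with N_(-1) = 0. *)
Definition prev_diff (k : nat) (g : R -> R) : R :=
  if k is k'.+1 then irwin_diff b d k' g else 0.

Lemma irwin_diff_recip_rec k n : (0 < n)%N ->
  irwin_diff b d k (recip n%:R) =
  ((k == 1)%:R - (k == 0)%:R) / (b%:R * n%:R)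
  + \sum_(a < b) irwin_diff b d k (recip (b * n + a)%:R)
  + (prev_diff k (recip (b * n + d)%:R) - irwin_diff b d k (recip (b * n + d)%:R)).
Proof.
move=> n0; case: k => [|k] /=; rewrite {1}/irwin_diff.
  rewrite irwin_mean0K (irwin_mean_recip_rec R b_gt1 d_lt_b) // !sub0r.
  have -> : \sum_(a < b) irwin_diff b d 0 (recip (b * n + a)%:R) =
      - \sum_(a < b) irwin_mean b d 1 (recip (b * n + a)%:R) :> R.
    by rewrite -sumrN; apply: eq_bigr => a _; rewrite /irwin_diff irwin_mean0K sub0r.
  rewrite /=; ring.
rewrite !(irwin_mean_recip_rec R b_gt1 d_lt_b) //= eqSS.
have -> : \sum_(a < b) irwin_diff b d k.+1 (recip (b * n + a)%:R) =
    \sum_(a < b) irwin_mean b d k.+1 (recip (b * n + a)%:R) -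
    \sum_(a < b) irwin_mean b d k.+2 (recip (b * n + a)%:R) :> R.
  by rewrite -sumrB.
ring.
Qed.

End FixedBase.

End Expansions.

(** * Reduction of the Irwin sum to moments *)

Section Formula.
Variable R : realType.

Lemma sum_inv_sqr_le2 X : \sum_(1 <= n < X) (n%:R : R)^-1 ^+ 2 <= 2.
Proof.
case: X => [|[|X]]; [by rewrite big_geq|by rewrite big_geq|].
suff : \sum_(1 <= n < X.+2) (n%:R : R)^-1 ^+ 2 <= 2 - X.+1%:R^-1.
  by move=> h; apply: le_trans h _; rewrite gerBl invr_ge0 ler0n.
elim: X => [|X IH]; first by rewrite big_nat1 invr1 expr1n; lra.
rewrite big_nat_recr //=.
have h : (X.+2%:R : R)^-1 ^+ 2 <= X.+1%:R^-1 - X.+2%:R^-1.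
  have -> : X.+1%:R^-1 - X.+2%:R^-1 = X.+2%:R^-1 * X.+1%:R^-1 :> R.
    have u0 : (X.+1%:R : R) != 0 by rewrite pnatr_eq0.
    have : (X.+2%:R : R) != 0 by rewrite pnatr_eq0.
    have -> : (X.+2%:R : R) = X.+1%:R + 1 by rewrite natr1.
    move: (X.+1%:R) u0 => u u0 u1; field; exact/andP.
  by rewrite expr2 ler_pM2l ?invr_gt0 ?ltr0n // lef_pV2 ?posrE ?ltr0n // ler_nat.
move: IH h; move: (\sum_(1 <= n < X.+2) _) (X.+2%:R^-1) (X.+1%:R^-1) => S u v.
by move: (u ^+ 2) => w; lra.
Qed.

Lemma inv_pow_le_sqr n i : (n%:R : R)^-1 ^+ i.+2 <= n%:R^-1 ^+ 2.
Proof.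
case: n => [|n]; first by rewrite invr0 !exprS !mul0r.
by rewrite ler_wiXn2l // ?invr_ge0 ?ler0n // invf_le1 ?ltr0n // ler1n.
Qed.

Lemma cvg_zeta i : (fun X => \sum_(1 <= n < X) (n%:R : R)^-1 ^+ i.+2) @ \oo -->
  zeta (i.+2%:R : R).
Proof.
pose u n : R := n.+1%:R^-1 ^+ i.+2.
have -> : zeta (i.+2%:R : R) = limn (series u).
  congr (limn (series _)); apply/funext => n.
  by rewrite /riemannR powR_mulrn ?ler0n // -exprVn.
have uE X : \sum_(1 <= n < X.+1) (n%:R : R)^-1 ^+ i.+2 = series u X.
  by rewrite big_add1.
rewrite -cvg_shiftS; under eq_fun do rewrite uE.
apply: nondecreasing_is_cvgn.
  apply/nondecreasing_seqP => X; rewrite -!uE [leRHS]big_nat_recr //= lerDl.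
  by rewrite exprn_ge0 ?invr_ge0 ?ler0n.
exists 2 => _ [X _ <-]; rewrite -uE; apply: le_trans (sum_inv_sqr_le2 X.+1).
by apply: ler_sum => n _; exact: inv_pow_le_sqr.
Qed.

Lemma cvg_norm_le (w : nat -> R) (l C : R) : w @ \oo --> l ->
  (forall n, `|w n| <= C) -> `|l| <= C.
Proof.
move=> wl wC; rewrite -(cvg_lim _ wl) //; have cw : cvgn w by apply: cvgP wl.
rewrite ler_norml; apply/andP; split.
- apply: limr_ge => //; near=> n; by have := wC n; rewrite ler_norml => /andP[].
- apply: limr_le => //; near=> n; by have := wC n; rewrite ler_norml => /andP[].
Unshelve. all: by end_near. Qed.

Variables d k : nat.
Local Notation Exp := (expandable (R := R) d.+2).
Local Notation bigO := (bigOinv (R := R) d.+2).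
Let b0_gt0 : (0 < d.+2)%N. Proof. by []. Qed.
Local Notation dm := (diff_moment R d).
Local Notation dsm := (diff_shifted_moment R d).

(** The expansion of the series over n >= 1, cut after J terms; the moment of
    degree 0 cancels against [k = 0]/(b n). *)
Definition tail_main (J b : nat) : R :=
  \sum_(i < J) (-1) ^+ i.+1 * zeta i.+2%:R * b%:R^-1 ^+ i.+2 * dsm k i.+1 b.

(** The contribution of n = 0, which is present only if d > 0. *)
Definition head_term (b : nat) : R :=
  if (0 < d)%N then irwin_diff b d k (recip d%:R) else 0.

Lemma tail_main_bound J :
  bigO J.+2 (fun b => irwin_sum R b d k / b%:R - ln b%:R - head_term b
                      - tail_main J b).
Proof.
exists (4 * (d%:R + 1) ^+ J.+1) => b bb.
have b1 : (1 < b)%N by lia.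
have db : (d < b)%N by lia.
have bR : (0 : R) < b%:R by rewrite ltr0n ltnW.
pose E n : R := (k == 0)%:R / (b%:R * n%:R) + irwin_diff b d k (recip (b * n + d)%:R).
pose V X : R := \sum_(i < J) (-1) ^+ i.+1 * b%:R^-1 ^+ i.+2 * dsm k i.+1 b *
   \sum_(1 <= n < X) n%:R^-1 ^+ i.+2.
have cE := @irwin_sum_tail R b d b1 db k.
have cV : V @ \oo --> tail_main J b.
  have -> : tail_main J b = \sum_(i < J) (-1) ^+ i.+1 * b%:R^-1 ^+ i.+2 *
      dsm k i.+1 b * zeta i.+2%:R by apply: eq_bigr => i _; ring.
  apply: cvg_big => [|i _]; first exact: add_continuous.
  by apply: cvgMl_tmp; exact: cvg_zeta.
apply: (cvg_norm_le (cvgB cE cV)) => X.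
rewrite [X in `|X|](_ : _ = \sum_(1 <= n < X) (E n - \sum_(i < J)
    (-1) ^+ i.+1 * b%:R^-1 ^+ i.+2 * dsm k i.+1 b * n%:R^-1 ^+ i.+2)); last first.
  rewrite sumrB exchange_big /=; congr (_ - _); apply: eq_bigr => i _.
  by rewrite mulr_sumr.
apply: le_trans (ler_norm_sum _ _ _) _.
apply: le_trans (_ : \sum_(1 <= n < X) 2 * (d%:R + 1) ^+ J.+1 * b%:R^-1 ^+ J.+2 *
    n%:R^-1 ^+ 2 <= _); last first.
  rewrite -mulr_sumr.
  have -> : 4 * (d%:R + 1) ^+ J.+1 * b%:R^-1 ^+ J.+2 =
      2 * (d%:R + 1) ^+ J.+1 * b%:R^-1 ^+ J.+2 * 2 :> R by ring.
  rewrite ler_wpM2l ?sum_inv_sqr_le2 //.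
apply: ler_sum_nat => n /andP[n1 _].
have nR : (0 : R) < n%:R by rewrite ltr0n.
have z0 : (0 : R) < b%:R * n%:R by rewrite mulr_gt0.
have := irwin_diff_recip_expand b1 db k J.+1 z0 (ler0n R d).
set rhs := (X in _ <= X).
rewrite -natrM -natrD big_ord_recl /= expr0 mul1r expr1.
have -> : (fun y : R => (d%:R + y) ^+ 0) = (fun=> 1) by apply/funext => y; rewrite expr0.
rewrite irwin_diff_mass // => h.
have -> : E n - \sum_(i < J) (-1) ^+ i.+1 * b%:R^-1 ^+ i.+2 * dsm k i.+1 b * n%:R^-1 ^+ i.+2
   = irwin_diff b d k (recip (b * n + d)%:R) -
     ((b * n)%:R^-1 * - (k == 0)%:R +
      \sum_(i < J) (-1) ^+ bump 0 i * (b * n)%:R^-1 ^+ (bump 0 i).+1 *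
       irwin_diff b d k (fun y => (d%:R + y) ^+ bump 0 i)).
  have -> : \sum_(i < J) (-1) ^+ bump 0 i * (b * n)%:R^-1 ^+ (bump 0 i).+1 *
       irwin_diff b d k (fun y => (d%:R + y) ^+ bump 0 i) =
      \sum_(i < J) (-1) ^+ i.+1 * b%:R^-1 ^+ i.+2 * dsm k i.+1 b * n%:R^-1 ^+ i.+2 :> R.
    apply: eq_bigr => i _; rewrite /bump leq0n add1n natrM invfM exprMn.
    by rewrite /diff_shifted_moment; ring.
  rewrite /E natrM; ring.
apply: le_trans h _; rewrite /rhs.
rewrite invfM exprMn.
have := inv_pow_le_sqr n J.
have : (0 : R) <= (d%:R + 1) ^+ J.+1 by rewrite exprn_ge0 ?addr_ge0 ?ler0n.
have : (0 : R) <= b%:R^-1 ^+ J.+2 by rewrite exprn_ge0 ?invr_ge0 ?ler0n.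
move: (_ ^+ J.+1) (b%:R^-1 ^+ J.+2) (n%:R^-1 ^+ J.+2) (n%:R^-1 ^+ 2) => D B u v.
move=> B0 D0 uv; have -> : 2 * (D * (B * u)) = 2 * D * B * u by ring.
by rewrite ler_wpM2l // !mulr_ge0.
Qed.

(** The moment of N_k plus [k = 0] times that of Lebesgue measure, which
    vanishes in degree 0. *)
Definition moment_defect (i b : nat) : R := dm k i b + (k == 0)%:R / i.+1%:R.

(** The moments of (d + y)^i under N_(k-1), with N_(-1) = 0. *)
Definition prev_shifted (i b : nat) : R :=
  if k is k'.+1 then dsm k' i b else 0.

(** The expansion of the term n = 0, cut after J terms in each sum; the
    logarithm is present only if k = 0. *)
Definition head_main (J b : nat) : R :=
  - (k == 0)%:R * ln (1 + 1 / d%:R)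
  + \sum_(i < J) (-1) ^+ i.+1 * moment_defect i.+1 b * inv_power_sum R d i.+1 b
  + \sum_(i < J) (-1) ^+ i.+1 * b%:R^-1 ^+ i.+2 * d%:R^-1 ^+ i.+2 *
      (prev_shifted i.+1 b - dsm k i.+1 b).

(** After one use of self-similarity, the logarithms of the expansions of
    1/(m + y), for b d <= m < b d + b, add up to ln(1 + 1/d). *)
Lemma head_main_bound J : (0 < d)%N ->
  bigO J.+1 (fun b => head_term b - head_main J b).
Proof.
move=> d0; have dR : (0 : R) < d%:R by rewrite ltr0n.
have dN0 : (d%:R : R) != 0 by rewrite gt_eqF.
exists (3 + 4 * (d%:R + 1) ^+ J.+1) => b bb.
have b1 : (1 < b)%N by lia.
have db : (d < b)%N by lia.
have bR : (0 : R) < b%:R by rewrite ltr0n ltnW.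
have bN0 : (b%:R : R) != 0 by rewrite gt_eqF.
rewrite /head_term d0 (irwin_diff_recip_rec R b1 db) //.
pose m (a : nat) := (b * d + a)%N.
have mpos a : (0 < m a)%N by rewrite addn_gt0 muln_gt0 d0 (ltnW b1).
have bm a : (b <= m a)%N by rewrite (leq_trans _ (leq_addr _ _)) // leq_pmulr.
(* When k = 0, N_k is close to minus Lebesgue measure; adding the logarithm
   turns the moments of the expansion into [moment_defect]. *)
pose Q a : R := irwin_diff b d k (recip (m a)%:R) +
   (k == 0)%:R * (ln (m a).+1%:R - ln (m a)%:R).
have lnsum : \sum_(a < b) (ln (m a).+1%:R - ln (m a)%:R) = ln (1 + 1 / d%:R) :> R.
  rewrite -(big_mkord xpredT (fun a => ln (m a).+1%:R - ln (m a)%:R)).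
  under eq_bigr do rewrite -addnS.
  rewrite (telescope_sumr (fun a => ln (m a)%:R)) // /m addn0.
  rewrite -ln_div ?posrE ?ltr0n ?addn_gt0 ?muln_gt0 ?d0 ?(ltnW b1) //.
  by congr ln; rewrite natrD natrM; field; exact/andP.
have Qbound a : `|Q a - \sum_(i < J) (-1) ^+ i.+1 * moment_defect i.+1 b * (m a)%:R^-1 ^+ i.+2|
    <= 3 * b%:R^-1 ^+ J.+2.
  have mR : (0 : R) < (m a)%:R by rewrite ltr0n.
  have := irwin_diff_recip_expand b1 db k J.+1 mR (lexx 0).
  rewrite addr0 add0r expr1n mul1r => h1.
  have h2 : `|(k == 0)%:R * ((ln (m a).+1%:R - ln (m a)%:R) -
      \sum_(i < J.+1) (-1) ^+ i * (m a)%:R^-1 ^+ i.+1 / i.+1%:R)| <= (m a)%:R^-1 ^+ J.+2 :> R.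
    rewrite normrM; apply: le_trans (ln_succ_expand R J.+1 (mpos a)).
    rewrite ger0_norm ?ler0n // ler_piMl //.
    by case: (k == 0).
  have mb : (m a)%:R^-1 ^+ J.+2 <= b%:R^-1 ^+ J.+2 :> R.
    rewrite lerXn2r ?nnegrE ?invr_ge0 ?ler0n // lef_pV2 ?posrE ?ltr0n ?(ltnW b1) //.
    by rewrite ler_nat.
  have -> : Q a - \sum_(i < J) (-1) ^+ i.+1 * moment_defect i.+1 b * (m a)%:R^-1 ^+ i.+2 =
    (irwin_diff b d k (recip (m a)%:R) - \sum_(i < J.+1) (-1) ^+ i *
       (m a)%:R^-1 ^+ i.+1 * irwin_diff b d k (fun y => (0 + y) ^+ i)) +
    (k == 0)%:R * ((ln (m a).+1%:R - ln (m a)%:R) -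
      \sum_(i < J.+1) (-1) ^+ i * (m a)%:R^-1 ^+ i.+1 / i.+1%:R).
    have -> : \sum_(i < J) (-1) ^+ i.+1 * moment_defect i.+1 b * (m a)%:R^-1 ^+ i.+2 =
       \sum_(i < J.+1) (-1) ^+ i * (m a)%:R^-1 ^+ i.+1 *
          irwin_diff b d k (fun y => (0 + y) ^+ i) +
       (k == 0)%:R * \sum_(i < J.+1) (-1) ^+ i * (m a)%:R^-1 ^+ i.+1 / i.+1%:R :> R.
      rewrite mulr_sumr -big_split /= big_ord_recl /=.
      have -> : (fun y : R => (0 + y) ^+ 0) = (fun=> 1).
        by apply/funext => y; rewrite expr0.
      rewrite irwin_diff_mass // [X in _ = X + _](_ : _ = 0) ?add0r;
        last by (field; rewrite gt_eqF).
      apply: eq_bigr => i _; rewrite /bump leq0n add1n /moment_defect /diff_moment.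
      have -> : (fun y : R => (0 + y) ^+ i.+1) = (fun y => y ^+ i.+1).
        by apply/funext => y; rewrite add0r.
      ring.
    rewrite /Q; ring.
  by apply: le_trans (ler_normD _ _) _; move: h1 h2 mb; lra.
have z0 : (0 : R) < b%:R * d%:R by rewrite mulr_gt0.
have e1 k' : `|irwin_diff b d k' (recip (b * d + d)%:R) -
   (- (k' == 0)%:R / (b%:R * d%:R) + \sum_(i < J) (-1) ^+ i.+1 * b%:R^-1 ^+ i.+2 *
     d%:R^-1 ^+ i.+2 * dsm k' i.+1 b)| <= 2 * (d%:R + 1) ^+ J.+1 * b%:R^-1 ^+ J.+1.
  have := irwin_diff_recip_expand b1 db k' J.+1 z0 (ler0n R d).
  set rhs := (X in _ <= X).
  rewrite -natrM -natrD big_ord_recl /= expr0 mul1r expr1.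
  have -> : (fun y : R => (d%:R + y) ^+ 0) = (fun=> 1).
    by apply/funext => y; rewrite expr0.
  rewrite irwin_diff_mass // => h.
  apply: le_trans (le_trans _ h) _.
    rewrite le_eqVlt; apply/orP; left; apply/eqP; congr `|_ - (_ + _)|.
      by rewrite natrM mulrC.
    apply: eq_bigr => i _; rewrite /bump leq0n add1n natrM invfM exprMn.
    by rewrite /diff_shifted_moment; ring.
  rewrite /rhs mulrA ler_wpM2l ?mulr_ge0 ?exprn_ge0 ?addr_ge0 ?ler0n //.
  rewrite ?natrM invfM exprMn exprSr -[leRHS]mulr1 -mulrA ler_wpM2l ?exprn_ge0 ?invr_ge0 ?ler0n //.
  rewrite mulr_ile1 ?exprn_ge0 ?invr_ge0 ?ler0n ?exprn_ile1 ?invr_ge0 ?ler0n //;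
  by rewrite invf_le1 ?ltr0n ?ler1n // ltnW.
have e2 : `|prev_diff b d k (recip (b * d + d)%:R) -
   (- (k == 1)%:R / (b%:R * d%:R) + \sum_(i < J) (-1) ^+ i.+1 * b%:R^-1 ^+ i.+2 *
     d%:R^-1 ^+ i.+2 * prev_shifted i.+1 b)| <= 2 * (d%:R + 1) ^+ J.+1 * b%:R^-1 ^+ J.+1.
  rewrite /prev_diff /prev_shifted; case: k => [|k'] /=; last exact: e1.
  rewrite big1 => [|i _]; last by rewrite mulr0.
  by rewrite oppr0 mul0r addr0 subr0 normr0 !mulr_ge0 ?exprn_ge0 ?invr_ge0 ?addr_ge0 ?ler0n.
have e3 : `|\sum_(a < b) Q a - \sum_(i < J) (-1) ^+ i.+1 * moment_defect i.+1 b *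
     inv_power_sum R d i.+1 b| <= 3 * b%:R^-1 ^+ J.+1.
  have -> : \sum_(i < J) (-1) ^+ i.+1 * moment_defect i.+1 b * inv_power_sum R d i.+1 b =
      \sum_(a < b) \sum_(i < J) (-1) ^+ i.+1 * moment_defect i.+1 b * (m a)%:R^-1 ^+ i.+2.
    by rewrite exchange_big /=; apply: eq_bigr => i _; rewrite mulr_sumr.
  rewrite -sumrB; apply: le_trans (ler_norm_sum _ _ _) _.
  apply: le_trans (_ : \sum_(a < b) 3 * b%:R^-1 ^+ J.+2 <= _).
    by apply: ler_sum => a _; exact: Qbound.
  rewrite sumr_const card_ord -[X in X <= _]mulr_natl (exprS _ J.+1).
  by move: (_ ^+ J.+1) => B; rewrite le_eqVlt; apply/orP; left; apply/eqP; field.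
have sumQ : \sum_(a < b) Q a = \sum_(a < b) irwin_diff b d k (recip (m a)%:R) +
    (k == 0)%:R * ln (1 + 1 / d%:R).
  by rewrite big_split /= -mulr_sumr lnsum.
have := e1 k; move: e2 e3; rewrite sumQ /head_main.
have -> : \sum_(i < J) (-1) ^+ i.+1 * b%:R^-1 ^+ i.+2 * d%:R^-1 ^+ i.+2 *
      (prev_shifted i.+1 b - dsm k i.+1 b) =
   \sum_(i < J) (-1) ^+ i.+1 * b%:R^-1 ^+ i.+2 * d%:R^-1 ^+ i.+2 * prev_shifted i.+1 b
   - \sum_(i < J) (-1) ^+ i.+1 * b%:R^-1 ^+ i.+2 * d%:R^-1 ^+ i.+2 * dsm k i.+1 b.
  by rewrite -sumrB; apply: eq_bigr => i _; rewrite mulrBr.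
rewrite -/(m d) !mulNr [((k == 1)%:R - (k == 0)%:R) / _]mulrBl.
rewrite (mulrDl 3) [4 * _](_ : _ = 2 * (d%:R + 1) ^+ J.+1 + 2 * (d%:R + 1) ^+ J.+1);
  last by ring.
rewrite (mulrDl (2 * _)).
pose s1 : R := \sum_(a < b) irwin_diff b d k (recip (m a)%:R).
rewrite -[\sum_(a < b) irwin_diff b d k (recip (b * d + a)%:R)]/s1 -/s1.
set s2 := \sum_(i < J) (-1) ^+ i.+1 * b%:R^-1 ^+ i.+2 * d%:R^-1 ^+ i.+2 *
  prev_shifted i.+1 b.
set s3 := \sum_(i < J) (-1) ^+ i.+1 * b%:R^-1 ^+ i.+2 * d%:R^-1 ^+ i.+2 *
  dsm k i.+1 b.
set s4 := \sum_(i < J) (-1) ^+ i.+1 * moment_defect i.+1 b * inv_power_sum R d i.+1 b.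
set l := (k == 0)%:R * ln _; set p := (k == 1)%:R / _; set q := (k == 0)%:R / _.
set c1 := 2 * _ * _; set c2 := 3 * _.
set u := prev_diff _ _ _ _; set v := irwin_diff _ _ _ (recip (m d)%:R).
move: s1 s2 s3 s4 l p q c1 c2 u v => s1 s2 s3 s4 l p q c1 c2 u v.
rewrite !ler_norml => /andP[h1 h2] /andP[h3 h4] /andP[h5 h6].
by apply/andP; split; lra.
Qed.

End Formula.

(** * First terms of the expansion *)

Section Normalized.
Variable R : realType.

(** The quantity (I(b,d,k) - b ln b) / b, whose expansion has no negative
    power of 1/b. *)
Definition normalized_excess (d k b : nat) : R := irwin_sum R b d k / b%:R - ln b%:R.
Local Notation G := normalized_excess.
Local Notation bigO d := (bigOinv (R := R) d.+2).
Local Notation Exp d := (expandable (R := R) d.+2).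
Let b0_gt0 d : (0 < d.+2)%N. Proof. by []. Qed.

(** The approximation of [normalized_excess] up to O(b^-(J+1)). *)
Definition main_part (d k J b : nat) : R :=
  (if (0 < d)%N then head_main R d k J b else 0) + tail_main R d k J b.

Lemma main_part_bound d k J :
  bigO d J.+1 (fun b => G d k b - main_part d k J b).
Proof.
have tO := bigOinvW (b0_gt0 d) (leqnSn J.+1) (tail_main_bound R d k J).
have hO : bigO d J.+1 (fun b => head_term R d k b -
    (if (0 < d)%N then head_main R d k J b else 0)).
  case: (posnP d) => [d0|d0]; last exact: head_main_bound.
  apply: (@eq_bigOinv _ _ _ (fun=> 0)) => [b _|]; last exact: bigOinv0.
  by rewrite /head_term d0 /= subr0.
apply: eq_bigOinv (bigOinvD tO hO) => b _; rewrite /G /main_part; ring.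
Qed.

Lemma normalized_excess_expandable d k : Exp d (G d k).
Proof.
apply: (expandable_approx (b0 := d.+2)) => J; exists (main_part d k J); last first.
  by apply: (bigOinvW (b0_gt0 d) (leqnSn J)); exact: main_part_bound.
have b0 := b0_gt0 d.
apply: expandable_D => //; last first.
  apply: expandable_sum => i _; apply: expandable_M => //;
    last exact: diff_shifted_moment_expandable.
  by apply: expandable_Z => //; apply: expandable_pow => //; exact: expandable_inv.
case: (posnP d) => [d0|d0]; first exact: expandable_cst.
apply: expandable_D => //; first apply: expandable_D => //.
- exact: expandable_cst.
- apply: expandable_sum => i _; apply: expandable_M => //; last exact: inv_power_sum_expandable.
  apply: expandable_Z => //; apply: expandable_D => //; last exact: expandable_cst.
  exact: diff_moment_expandable.
apply: expandable_sum => i _; apply: expandable_M => //; last first.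
  apply: expandable_B => //; last exact: diff_shifted_moment_expandable.
  rewrite /prev_shifted; case: k => [|k']; first exact: expandable_cst.
  exact: diff_shifted_moment_expandable.
apply: expandable_M => //; last exact: expandable_cst.
by apply: expandable_Z => //; apply: expandable_pow => //; exact: expandable_inv.
Qed.

Lemma diff_shifted_moment1 d k b : (d.+2 <= b)%N ->
  diff_shifted_moment R d k 1 b =
  d%:R * - (k == 0)%:R + diff_moment R d k 1 b.
Proof.
move=> bb; rewrite diff_shifted_momentE // !big_ord_recr big_ord0 /= diff_moment0 //.
by rewrite bin0 binn subnn expr0 expr1 !mul1r add0r.
Qed.

Lemma diff_shifted_moment2 d k b : (d.+2 <= b)%N ->
  diff_shifted_moment R d k 2 b =
  d%:R ^+ 2 * - (k == 0)%:R + 2 * d%:R * diff_moment R d k 1 b + diff_moment R d k 2 b.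
Proof.
move=> bb; rewrite diff_shifted_momentE // !big_ord_recr big_ord0 /= diff_moment0 //.
by rewrite bin0 bin1 binn subnn expr0 expr1 !mul1r add0r.
Qed.

Lemma diff_shifted_moment01_asymp d :
  bigO d 2 (fun b => diff_shifted_moment R d 0 1 b - - (d%:R + 1 / 2)).
Proof.
have [r rb rE] := bigOinv_factor (b0_gt0 d) (mean_moment1_asymp R d).
pose s b : R := d%:R + 1 / 2 - b%:R^-1 * r b.
apply: (@eq_bigOinv _ _ _ (fun b => b%:R^-1 ^+ 2 * s b)) => [b bb|]; last first.
  by apply: bigOinv_scaled; rewrite /s; bigO_bounded.
rewrite diff_shifted_moment1 // diff_momentE mean_moment0K /s.
have -> : mean_moment R d 1 1 b =
    1 / 2 - (d%:R + 1 / 2) * b%:R^-1 ^+ 2 + b%:R^-1 ^+ 3 * r b.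
  by rewrite -rE //; ring.
by rewrite /=; ring.
Qed.

Lemma diff_shifted_moment02_asymp d :
  bigO d 2 (fun b => diff_shifted_moment R d 0 2 b - - (d%:R ^+ 2 + d%:R + 1 / 3)).
Proof.
have [r rb rE] := bigOinv_factor (b0_gt0 d) (mean_moment1_asymp R d).
have [t tb tE] := bigOinv_factor (b0_gt0 d) (mean_moment2_asymp R d).
pose s b : R := 2 * d%:R * (d%:R + 1 / 2 - b%:R^-1 * r b) - t b.
apply: (@eq_bigOinv _ _ _ (fun b => b%:R^-1 ^+ 2 * s b)) => [b bb|]; last first.
  by apply: bigOinv_scaled; rewrite /s; bigO_bounded.
rewrite diff_shifted_moment2 // !diff_momentE !mean_moment0K /s.
have -> : mean_moment R d 1 1 b =
    1 / 2 - (d%:R + 1 / 2) * b%:R^-1 ^+ 2 + b%:R^-1 ^+ 3 * r b.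
  by rewrite -rE //; ring.
have -> : mean_moment R d 1 2 b = 1 / 3 + b%:R^-1 ^+ 2 * t b by rewrite -tE //; ring.
by rewrite /=; field; rewrite pnatr_eq0 -lt0n (leq_trans (b0_gt0 d) bb).
Qed.

Lemma diff_shifted_moment_bounded d k j : bigO d 0 (diff_shifted_moment R d k j).
Proof. exact: (expandable_bounded (b0_gt0 d) (diff_shifted_moment_expandable R d k j)). Qed.

Lemma normalized_excess00_asymp : bigO 0 4 (fun b => G 0 0 b -
  (zeta 2 / 2 * b%:R^-1 ^+ 2 - zeta 3 / 3 * b%:R^-1 ^+ 3)).
Proof.
have b0 := b0_gt0 0.
have [g gb gE] := bigOinv_factor b0 (main_part_bound 0 0 3).
have [r rb rE] := bigOinv_factor b0 (diff_shifted_moment01_asymp 0).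
have [t tb tE] := bigOinv_factor b0 (diff_shifted_moment02_asymp 0).
have d3 := diff_shifted_moment_bounded 0 0 3.
(* b^-4 s(b) collects everything beyond the claimed terms. *)
pose s b : R := g b - zeta 2 * r b + zeta 3 * b%:R^-1 * t b
  - zeta 4 * diff_shifted_moment R 0 0 3 b.
apply: (@eq_bigOinv _ _ _ (fun b => b%:R^-1 ^+ 4 * s b)) => [b bb|]; last first.
  by apply: bigOinv_scaled; rewrite /s; bigO_bounded.
have := gE b bb; rewrite /main_part /tail_main !big_ord_recr big_ord0 /= => g1.
have e1 : diff_shifted_moment R 0 0 1 b = - (1 / 2) + b%:R^-1 ^+ 2 * r b.
  by rewrite -rE //; ring.
have e2 : diff_shifted_moment R 0 0 2 b = - (1 / 3) + b%:R^-1 ^+ 2 * t b.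
  by rewrite -tE //; ring.
rewrite e1 e2 in g1.
have -> : G 0 0 b = b%:R^-1 ^+ 4 * g b + (0 + (0 +
  (-1) ^+ 1 * zeta 2 * b%:R^-1 ^+ 2 * (- (1 / 2) + b%:R^-1 ^+ 2 * r b) +
  (-1) ^+ 2 * zeta 3 * b%:R^-1 ^+ 3 * (- (1 / 3) + b%:R^-1 ^+ 2 * t b) +
  (-1) ^+ 3 * zeta 4 * b%:R^-1 ^+ 4 * diff_shifted_moment R 0 0 3 b)).
  by rewrite -g1; ring.
by rewrite /s; field; rewrite pnatr_eq0 -lt0n (leq_trans b0 bb).
Qed.

Lemma normalized_excess0S_asymp k : bigO 0 (2 * k + 6) (fun b => G 0 k.+1 b -
  (zeta 2 / 2 * b%:R^-1 ^+ (2 * k + 4)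
   + k.+1%:R * zeta 2 / 2 * b%:R^-1 ^+ (2 * k + 5))).
Proof.
have b0 := b0_gt0 0.
have mO := main_part_bound 0 k.+1 (2 * k + 5).
have dO := diff_moment1_asymp R 0 k.
have dsmE j b : diff_shifted_moment R 0 k.+1 j b = diff_moment R 0 k.+1 j b.
  rewrite /diff_shifted_moment /diff_moment; congr irwin_diff.
  by apply/funext => y; rewrite add0r.
pose rest b : R := \sum_(i < 2 * k + 4) (-1) ^+ i.+2 * zeta i.+3%:R *
    (b%:R^-1 ^+ i.+3 * diff_moment R 0 k.+1 i.+2 b).
have restO : bigO 0 (2 * k + 6) rest.
  apply: bigOinv_sum => i _; apply: bigOinvZ.
  apply: (bigOinvW b0 (N := i.+3 + (2 * k + 3))); first by lia.
  by apply: bigOinvM; [exact: bigOinv_pow|exact: diff_moment_bigO2].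
have d2O := bigOinvZ (- zeta 2) (bigOinvM (bigOinv_pow R 2 2) dO).
apply: eq_bigOinv (bigOinvD (bigOinvD (bigOinvW b0 _ mO) restO) (bigOinvW b0 _ d2O));
  [|lia|lia].
move=> b bb.
have bN0 : (b%:R : R) != 0 by rewrite pnatr_eq0 -lt0n (leq_trans b0 bb).
rewrite /main_part /= /tail_main add0r.
rewrite (_ : (2 * k + 5 = (2 * k + 4).+1)%N); last by lia.
rewrite [X in _ - X + _ + _ = _]big_ord_recl.
rewrite [X in _ - (_ + X) + _ + _ = _](_ : _ = rest b); last first.
  by apply: eq_bigr => i _; rewrite lift0 dsmE; ring.
rewrite [nat_of_ord ord0]/= dsmE (_ : (2 * k + 4 = (2 * k + 2) + 2)%N); last by lia.
rewrite -[(2 * k + 2 + 2).+1]addn1 (exprD _ _ 1) !(exprD _ (2 * k + 2) 2).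
move: (b%:R^-1 ^+ (2 * k + 2)) => B; field; exact: bN0.
Qed.

Section PositiveDigit.
Variable d : nat.
Hypothesis d_gt0 : (0 < d)%N.
Let b0 : (0 < d.+2)%N. Proof. by []. Qed.
Let dN0 : (d%:R : R) != 0. Proof. by rewrite pnatr_eq0 -lt0n. Qed.
Let d1N0 : (d%:R + 1 : R) != 0. Proof. by rewrite natr1 pnatr_eq0. Qed.
Let bN0 b : (d.+2 <= b)%N -> (b%:R : R) != 0.
Proof. by move=> bb; rewrite pnatr_eq0 -lt0n (leq_trans b0 bb). Qed.

Lemma normalized_excess_d0_asymp : bigO d 4 (fun b => G d 0 b -
  (- ln (1 + 1 / d%:R) + (d%:R + 1 / 2) * (zeta 2 - d%:R ^- 2) * b%:R^-1 ^+ 2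
   - ((d%:R ^+ 2 + d%:R + 1 / 3) * zeta 3
      - (9 * d%:R ^+ 2 + 8 * d%:R + 2) / (6 * d%:R ^+ 3 * (d%:R + 1))) * b%:R^-1 ^+ 3)).
Proof.
have [g gb gE] := bigOinv_factor b0 (main_part_bound d 0 3).
have [r rb rE] := bigOinv_factor b0 (diff_shifted_moment01_asymp d).
have [t tb tE] := bigOinv_factor b0 (diff_shifted_moment02_asymp d).
have d3 := diff_shifted_moment_bounded d 0 3.
have [p1 p1b p1E] := bigOinv_factor b0 (mean_moment1_asymp R d).
have [p2 p2b p2E] := bigOinv_factor b0 (mean_moment2_asymp R d).
have [p3 p3b p3E] := bigOinv_factor b0 (mean_moment_asymp R d 3).
have [s1 s1b s1E] := bigOinv_factor b0 (inv_power_sum1_bigO R b0 d_gt0).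
have [s2 s2b s2E] := bigOinv_factor b0 (inv_power_sum_bigO R b0 d_gt0 2).
have [s3 s3b s3E] := bigOinv_factor b0 (inv_power_sum_bigO R b0 d_gt0 3).
(* b^-4 s(b) collects everything beyond the claimed terms. *)
pose s b : R := g b - zeta 2 * r b + zeta 3 * b%:R^-1 * t b
  - zeta 4 * diff_shifted_moment R d 0 3 b
  - ((d%:R + 1 / 2) * s1 b - p1 b * (1 / (d%:R * (d%:R + 1)) + b%:R^-1 * s1 b))
  - p2 b * s2 b + p3 b * s3 b
  + d%:R^-1 ^+ 2 * r b - d%:R^-1 ^+ 3 * b%:R^-1 * t b
  + d%:R^-1 ^+ 4 * diff_shifted_moment R d 0 3 b.
apply: (@eq_bigOinv _ _ _ (fun b => b%:R^-1 ^+ 4 * s b)) => [b bb|]; last first.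
  by apply: bigOinv_scaled; rewrite /s; bigO_bounded.
have := gE b bb; rewrite /main_part d_gt0 /head_main /tail_main /moment_defect /=.
rewrite !big_ord_recr !big_ord0 /= !diff_momentE !mean_moment0K.
have -> : diff_shifted_moment R d 0 1 b = - (d%:R + 1 / 2) + b%:R^-1 ^+ 2 * r b.
  by rewrite -rE //; ring.
have -> : diff_shifted_moment R d 0 2 b =
    - (d%:R ^+ 2 + d%:R + 1 / 3) + b%:R^-1 ^+ 2 * t b.
  by rewrite -tE //; ring.
have -> : mean_moment R d 1 1 b =
    1 / 2 - (d%:R + 1 / 2) * b%:R^-1 ^+ 2 + b%:R^-1 ^+ 3 * p1 b.
  by rewrite -p1E //; ring.
have -> : mean_moment R d 1 2 b = 1 / 3 + b%:R^-1 ^+ 2 * p2 b by rewrite -p2E //; ring.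
have -> : mean_moment R d 1 3 b = 4^-1 + b%:R^-1 ^+ 1 * p3 b by rewrite -p3E //; ring.
have -> : inv_power_sum R d 1 b =
    b%:R^-1 / (d%:R * (d%:R + 1)) + b%:R^-1 ^+ 2 * s1 b by rewrite -s1E //; ring.
rewrite s2E // s3E //.
move=> gE'.
have -> : G d 0 b = b%:R^-1 ^+ 4 * g b + (G d 0 b - b%:R^-1 ^+ 4 * g b) by ring.
rewrite -{2}gE' /s.
move: (diff_shifted_moment R d 0 3 b) (ln _) (G d 0 b) (g b) (r b) (t b) (p1 b)
  (p2 b) (p3 b) (s1 b) (s2 b) (s3 b).
move=> *; field; by rewrite d1N0 bN0 // dN0.
Qed.

End PositiveDigit.

End Normalized.

Section PositiveDigitMore.
Variable R : realType.
Local Notation G := (normalized_excess R).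
Local Notation bigO d := (bigOinv (R := R) d.+2).
Variable d : nat.
Hypothesis d_gt0 : (0 < d)%N.
Let b0 : (0 < d.+2)%N. Proof. by []. Qed.
Let dN0 : (d%:R : R) != 0. Proof. by rewrite pnatr_eq0 -lt0n. Qed.
Let d1N0 : (d%:R + 1 : R) != 0. Proof. by rewrite natr1 pnatr_eq0. Qed.
Let bN0 b : (d.+2 <= b)%N -> (b%:R : R) != 0.
Proof. by move=> bb; rewrite pnatr_eq0 -lt0n (leq_trans b0 bb). Qed.

Lemma normalized_excess_d1_asymp : bigO d 4 (fun b => G d 1 b -
  ((d%:R + 1 / 2) / d%:R ^+ 2 * b%:R^-1 ^+ 2
   - (9 * d%:R ^+ 2 + 8 * d%:R + 2) / (6 * d%:R ^+ 3 * (d%:R + 1)) * b%:R^-1 ^+ 3)).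
Proof.
have [g gb gE] := bigOinv_factor b0 (main_part_bound R d 1 3).
have [r rb rE] := bigOinv_factor b0 (diff_shifted_moment01_asymp R d).
have [t tb tE] := bigOinv_factor b0 (diff_shifted_moment02_asymp R d).
have d3 := diff_shifted_moment_bounded R d 0 3.
have [r1 r1b r1E] := bigOinv_factor b0 (diff_moment1_asymp R d 0).
have [q2 q2b q2E] := bigOinv_factor b0 (diff_moment_bigO2 R d 0 (isT : (1 < 2)%N)).
have [q3 q3b q3E] := bigOinv_factor b0 (diff_moment_bigO2 R d 0 (isT : (1 < 3)%N)).
have [u1 u1b u1E] := bigOinv_factor b0 (diff_shifted_moment_bigO R d 1 1).
have [u2 u2b u2E] := bigOinv_factor b0 (diff_shifted_moment_bigO R d 1 2).
have [u3 u3b u3E] := bigOinv_factor b0 (diff_shifted_moment_bigO R d 1 3).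
have [s1 s1b s1E] := bigOinv_factor b0 (inv_power_sum1_bigO R b0 d_gt0).
have [s2 s2b s2E] := bigOinv_factor b0 (inv_power_sum_bigO R b0 d_gt0 2).
have [s3 s3b s3E] := bigOinv_factor b0 (inv_power_sum_bigO R b0 d_gt0 3).
(* b^-4 s(b) collects everything beyond the claimed terms. *)
pose s b : R := g b
  + (d%:R + 1 / 2) / (d%:R * (d%:R + 1)) + (d%:R + 1 / 2) * (1 + b%:R^-1) * s1 b
  - b%:R^-1 * r1 b * (1 / (d%:R * (d%:R + 1)) + b%:R^-1 * s1 b)
  + b%:R^-1 * q2 b * s2 b - b%:R^-1 ^+ 2 * q3 b * s3 b
  - d%:R^-1 ^+ 2 * (r b - u1 b) + d%:R^-1 ^+ 3 * b%:R^-1 * (t b - u2 b)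
  - d%:R^-1 ^+ 4 * (diff_shifted_moment R d 0 3 b - b%:R^-1 ^+ 2 * u3 b)
  - zeta 2 * u1 b + zeta 3 * b%:R^-1 * u2 b - zeta 4 * b%:R^-1 ^+ 2 * u3 b.
apply: (@eq_bigOinv _ _ _ (fun b => b%:R^-1 ^+ 4 * s b)) => [b bb|]; last first.
  by apply: bigOinv_scaled; rewrite /s; bigO_bounded.
have := gE b bb; rewrite /main_part d_gt0 /head_main /tail_main /moment_defect /=.
rewrite !big_ord_recr !big_ord0 /=.
have -> : diff_shifted_moment R d 0 1 b = - (d%:R + 1 / 2) + b%:R^-1 ^+ 2 * r b.
  by rewrite -rE //; ring.
have -> : diff_shifted_moment R d 0 2 b =
    - (d%:R ^+ 2 + d%:R + 1 / 3) + b%:R^-1 ^+ 2 * t b.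
  by rewrite -tE //; ring.
have -> : diff_moment R d 1 1 b =
    - (d%:R + 1 / 2) * b%:R^-1 ^+ 2 * (1 + b%:R^-1) + b%:R^-1 ^+ 4 * r1 b.
  by have := r1E b bb; rewrite /= mul1r => <-; ring.
have -> : inv_power_sum R d 1 b =
    b%:R^-1 / (d%:R * (d%:R + 1)) + b%:R^-1 ^+ 2 * s1 b by rewrite -s1E //; ring.
rewrite (q2E b bb) (q3E b bb) (u1E b bb) (u2E b bb) (u3E b bb) s2E // s3E //.
rewrite /= => gE'.
have -> : G d 1 b = b%:R^-1 ^+ 4 * g b + (G d 1 b - b%:R^-1 ^+ 4 * g b) by ring.
rewrite -{2}gE' /s.
move: (diff_shifted_moment R d 0 3 b) (ln _) (G d 1 b) (g b) (r b) (t b) (r1 b)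
  (q2 b) (q3 b) (u1 b) (u2 b) (u3 b) (s1 b) (s2 b) (s3 b).
move=> *; field; by rewrite d1N0 bN0 // dN0.
Qed.

(** Of the three sums in [main_part], only the first term of the first one and
    the first two of the second one contribute. *)
Lemma normalized_excess_dSS_asymp k : bigO d (2 * k + 6) (fun b => G d k.+2 b -
  ((d%:R + 1 / 2) / d%:R ^+ 2 * b%:R^-1 ^+ (2 * k + 4)
   + (d%:R + 1 / 2) * (k%:R * d%:R + k%:R - 1) / (d%:R ^+ 2 * (d%:R + 1))
     * b%:R^-1 ^+ (2 * k + 5))).
Proof.
have mO := main_part_bound R d k.+2 (2 * k + 5).
have [r1 r1b r1E] := bigOinv_factor b0 (diff_moment1_asymp R d k.+1).
have [r2 r2b r2E] := bigOinv_factor b0 (diff_moment1_asymp R d k).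
have [q qb qE] := bigOinv_factor b0 (diff_moment_bigO2 R d k (isT : (1 < 2)%N)).
have [s1 s1b s1E] := bigOinv_factor b0 (inv_power_sum1_bigO R b0 d_gt0).
pose rest1 b : R := \sum_(i < 2 * k + 4) (-1) ^+ i.+2 *
   (diff_moment R d k.+2 i.+2 b * inv_power_sum R d i.+2 b).
have rest1O : bigO d (2 * k + 6) rest1.
  apply: bigOinv_sum => i _; apply: bigOinvZ.
  apply: (bigOinvW b0 (N := (2 * k.+1 + 3) + i.+2)); first by lia.
  by apply: bigOinvM; [exact: diff_moment_bigO2|exact: inv_power_sum_bigO].
pose rest2 b : R := \sum_(i < 2 * k + 3) (-1) ^+ i.+3 * d%:R^-1 ^+ i.+4 *
   (b%:R^-1 ^+ i.+4 *
     (diff_shifted_moment R d k.+1 i.+3 b - diff_shifted_moment R d k.+2 i.+3 b)).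
have rest2O : bigO d (2 * k + 6) rest2.
  apply: bigOinv_sum => i _; apply: bigOinvZ.
  apply: (bigOinvW b0 (N := i.+4 + 2 * k.+1)); first by lia.
  apply: bigOinvM; first exact: bigOinv_pow.
  apply: bigOinvB; first exact: diff_shifted_moment_bigO.
  by apply: (bigOinvW b0 _ (diff_shifted_moment_bigO R d k.+2 _)); lia.
have restTO : bigO d (2 * k + 6) (tail_main R d k.+2 (2 * k + 5)).
  apply: (@eq_bigOinv _ _ _ (fun b => \sum_(i < 2 * k + 5) (-1) ^+ i.+1 *
    zeta i.+2%:R * (b%:R^-1 ^+ i.+2 * diff_shifted_moment R d k.+2 i.+1 b))).
    by move=> b bb; apply: eq_bigr => i _; ring.
  apply: bigOinv_sum => i _; apply: bigOinvZ.
  apply: (bigOinvW b0 (N := i.+2 + 2 * k.+2)); first by lia.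
  by apply: bigOinvM; [exact: bigOinv_pow|exact: diff_shifted_moment_bigO].
have rest3O c j e : (2 <= e)%N -> bigO d (2 * k + 6)
    (fun b => c * (b%:R^-1 ^+ e * diff_shifted_moment R d k.+2 j b)).
  move=> e2; apply: bigOinvZ.
  apply: (bigOinvW b0 (N := e + 2 * k.+2)); first by lia.
  by apply: bigOinvM; [exact: bigOinv_pow|exact: diff_shifted_moment_bigO].
(* b^-(2k+6) s(b) is what the contributing terms leave over. *)
pose s b : R := (d%:R + 1 / 2) * k.+2%:R / (d%:R * (d%:R + 1))
  + (d%:R + 1 / 2) * (1 + k.+2%:R * b%:R^-1) * s1 b
  - r1 b * (b%:R^-1 / (d%:R * (d%:R + 1)) + b%:R^-1 ^+ 2 * s1 b)
  - d%:R^-1 ^+ 2 * r2 b - 2 * d%:R^-1 ^+ 2 * (d%:R + 1 / 2) * k.+1%:R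
  + 2 * d%:R^-1 ^+ 2 * b%:R^-1 * r2 b + d%:R^-1 ^+ 3 * q b.
have sO : bigO d (2 * k + 6) (fun b => b%:R^-1 ^+ (2 * k + 6) * s b).
  by apply: bigOinv_scaled; rewrite /s; bigO_bounded.
have mO' : bigO d (2 * k + 6) (fun b => G d k.+2 b - main_part R d k.+2 (2 * k + 5) b).
  by apply: (bigOinvW b0 _ mO); lia.
have := bigOinvD (bigOinvD (bigOinvD (bigOinvD mO' rest1O) (bigOinvD rest2O restTO))
   (bigOinvD (rest3O (d%:R^-1 ^+ 2) 1%N 2 isT) (rest3O (- d%:R^-1 ^+ 3) 2%N 3 isT))) sO.
apply: eq_bigOinv => b bb.
rewrite /main_part d_gt0 /head_main.
move: (tail_main _ _ _ _ _) => T.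
have -> : \sum_(i < 2 * k + 5) (-1) ^+ i.+1 * moment_defect R d k.+2 i.+1 b *
    inv_power_sum R d i.+1 b =
    - diff_moment R d k.+2 1 b * inv_power_sum R d 1 b + rest1 b.
  rewrite (_ : (2 * k + 5 = (2 * k + 4).+1)%N); last by lia.
  rewrite big_ord_recl; congr (_ + _).
    by rewrite /moment_defect mul0r addr0 [nat_of_ord _]/= expr1 mulN1r.
  by apply: eq_bigr => i _; rewrite lift0 /moment_defect mul0r addr0; ring.
have -> : \sum_(i < 2 * k + 5) (-1) ^+ i.+1 * b%:R^-1 ^+ i.+2 * d%:R^-1 ^+ i.+2 *
    (prev_shifted R d k.+2 i.+1 b - diff_shifted_moment R d k.+2 i.+1 b) =
   - b%:R^-1 ^+ 2 * d%:R^-1 ^+ 2 *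
      (diff_shifted_moment R d k.+1 1 b - diff_shifted_moment R d k.+2 1 b)
   + b%:R^-1 ^+ 3 * d%:R^-1 ^+ 3 *
      (diff_shifted_moment R d k.+1 2 b - diff_shifted_moment R d k.+2 2 b)
   + rest2 b.
  rewrite (_ : (2 * k + 5 = (2 * k + 3).+2)%N); last by lia.
  rewrite big_ord_recl big_ord_recl addrA; congr (_ + _ + _).
  - by rewrite [nat_of_ord _]/= expr1 mulN1r.
  - by rewrite lift0 [nat_of_ord _]/= sqrrN expr1n mul1r.
  by apply: eq_bigr => i _; rewrite !lift0 /prev_shifted; ring.
rewrite (diff_shifted_moment1 R k.+1 bb) (diff_shifted_moment2 R k.+1 bb) /=.
have -> : diff_moment R d k.+2 1 b = - (d%:R + 1 / 2) * b%:R^-1 ^+ (2 * k + 4)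
    * (1 + k.+2%:R * b%:R^-1) + b%:R^-1 ^+ (2 * k + 6) * r1 b.
  have := r1E b bb; rewrite (_ : (2 * k.+1 + 4 = 2 * k + 6)%N); last by lia.
  rewrite (_ : (2 * k.+1 + 2 = 2 * k + 4)%N); last by lia.
  by move=> <-; ring.
have -> : diff_moment R d k.+1 1 b = - (d%:R + 1 / 2) * b%:R^-1 ^+ (2 * k + 2)
    * (1 + k.+1%:R * b%:R^-1) + b%:R^-1 ^+ (2 * k + 4) * r2 b.
  by rewrite -r2E //; ring.
rewrite (qE b bb).
have -> : inv_power_sum R d 1 b =
    b%:R^-1 / (d%:R * (d%:R + 1)) + b%:R^-1 ^+ 2 * s1 b by rewrite -s1E //; ring.
have ex j : b%:R^-1 ^+ (2 * k + 2 + j) = b%:R^-1 ^+ (2 * k + 2) * b%:R^-1 ^+ j :> R.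
  exact: exprD.
rewrite (_ : (2 * k + 6 = 2 * k + 2 + 4)%N); last by lia.
rewrite (_ : (2 * k + 5 = 2 * k + 2 + 3)%N); last by lia.
rewrite (_ : (2 * k + 4 = 2 * k + 2 + 2)%N); last by lia.
rewrite (_ : (2 * k + 3 = 2 * k + 2 + 1)%N); last by lia.
rewrite !ex /s -!natr1.
move: (b%:R^-1 ^+ (2 * k + 2)) (G d k.+2 b) (rest1 b) (rest2 b)
  (diff_shifted_moment R d k.+2 1 b) (diff_shifted_moment R d k.+2 2 b)
  (r1 b) (r2 b) (q b) (s1 b) (ln _).
move=> *; field; by rewrite d1N0 bN0 // dN0.
Qed.

End PositiveDigitMore.

(** * Coefficients of an expansion *)

Section Coefficients.
Variable R : realType.
Variable b0 : nat.
Hypothesis b0_gt0 : (0 < b0)%N.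
Local Notation bigO := (bigOinv (R := R) b0).
Local Notation Exp := (expandable (R := R) b0).

Lemma bigOinv1_cst (c : R) : bigO 1 (fun=> c) -> c = 0.
Proof.
move=> [C cC]; apply/eqP; rewrite -normr_eq0; apply/eqP; apply: le_anti.
rewrite normr_ge0 andbT; apply/ler_addgt0Pr => e e0; rewrite add0r.
have [n nC] : exists n : nat, `|C| / e <= n%:R.
  by exists (Num.trunc (`|C| / e)).+1; rewrite ltW // truncnS_gt.
pose b := maxn b0 n.+1.
have bR : (0 : R) < b%:R by rewrite ltr0n /b leq_max orbT.
apply: le_trans (cC b (leq_maxl _ _)) _; rewrite expr1 ler_pdivrMr //.
apply: le_trans (ler_norm C) _; rewrite -ler_pdivrMl // mulrC.
by apply: le_trans nC _; rewrite ler_nat /b leq_max leqnSn orbT.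
Qed.

(** Uniqueness of expansions: a polynomial in 1/b that is O(b^-N) has no
    coefficient of degree less than N. *)
Lemma bigOinv_poly_coef (P : {poly R}) N :
  bigO N (fun b => P.[b%:R^-1]) -> forall j, (j < N)%N -> P`_j = 0.
Proof.
move=> PN; elim/ltn_ind => j IH jN; apply: bigOinv1_cst.
pose Q b : R := \sum_(i < size P) P`_(j.+1 + i) * b%:R^-1 ^+ i.
have QO : bigO 0 Q by apply: bigOinv_sum => i _; apply: bigOinvZ; exact: bigOinv0_pow.
have hP b : P.[b%:R^-1] = b%:R^-1 ^+ j * (P`_j + b%:R^-1 * Q b).
  rewrite (horner_coef_wide _ (leq_addl j.+1 (size P))) big_split_ord /=.
  rewrite big_ord_recr /= big1 ?add0r => [|i _]; last first.
    by rewrite IH ?mul0r // (ltn_trans (ltn_ord i)).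
  rewrite mulrDr mulrC; congr (_ + _); rewrite /Q !mulr_sumr.
  apply: eq_bigr => i _; rewrite addSnnS exprD exprS; ring.
have [r rO rE] := bigOinv_factor b0_gt0 (bigOinvW b0_gt0 jN PN).
apply: (@eq_bigOinv _ _ _ (fun b => b%:R^-1 ^+ 1 * (r b - Q b))); last first.
  by apply: (bigOinv_scaled 1); apply: bigOinvB.
move=> b bb; have bN0 : (b%:R : R) != 0 by rewrite pnatr_eq0 -lt0n (leq_trans b0_gt0 bb).
have := rE b bb; rewrite hP exprS -mulrA mulrCA => /(mulfI _) e.
have {}e := e (expf_neq0 j (invr_neq0 bN0)).
by rewrite expr1 mulrBr -e; ring.
Qed.

(** The j-th coefficient is read off an approximating polynomial of order
    j + 1; by uniqueness, all later polynomials have it too. *)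
Lemma expandable_coefficients f : Exp f -> exists c : nat -> R, forall N,
  bigO N (fun b => f b - \sum_(j < N) c j * b%:R^-1 ^+ j).
Proof.
move=> /choice[P PN]; exists (fun j => (P j.+1)`_j) => N.
have coefE j : (j < N)%N -> (P N)`_j = (P j.+1)`_j.
  move=> jN; apply/eqP; rewrite -subr_eq0 -coefB; apply/eqP.
  apply: (@bigOinv_poly_coef _ j.+1) => //.
  apply: eq_bigOinv (bigOinvB (PN j.+1) (bigOinvW b0_gt0 jN (PN N))) => b _.
  by rewrite hornerD hornerN; ring.
pose Q b : R := \sum_(i < size (P N)) (P N)`_(N + i) * b%:R^-1 ^+ i.
have QO : bigO 0 Q by apply: bigOinv_sum => i _; apply: bigOinvZ; exact: bigOinv0_pow.
apply: eq_bigOinv (bigOinvD (PN N) (bigOinv_scaled N QO)) => b _.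
rewrite (horner_coef_wide _ (leq_addl N (size (P N)))) big_split_ord /=.
rewrite (eq_bigr (fun j : 'I_N => (P j.+1)`_j * b%:R^-1 ^+ j)); last first.
  by move=> j _; rewrite coefE.
rewrite (_ : \sum_(i < size (P N)) _ = b%:R^-1 ^+ N * Q b); first by ring.
by rewrite /Q mulr_sumr; apply: eq_bigr => i _; rewrite exprD; ring.
Qed.

Lemma leading_coefficients f (c : nat -> R) g q :
  (forall N, bigO N (fun b => f b - \sum_(j < N) c j * b%:R^-1 ^+ j)) ->
  bigO q.+1 (fun b => f b - g * b%:R^-1 ^+ q) ->
  c q = g /\ forall j, (j < q)%N -> c j = 0.
Proof.
move=> fc fg; pose P : {poly R} := \poly_(j < q.+1) c j - g *: 'X^q.
have PO : bigO q.+1 (fun b => P.[b%:R^-1]).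
  apply: eq_bigOinv (bigOinvB fg (fc q.+1)) => b _.
  by rewrite /P hornerD hornerN hornerZ hornerXn horner_poly; ring.
have Pc j : (j < q.+1)%N -> c j = g * (j == q)%:R.
  move=> jq; have := bigOinv_poly_coef PO jq.
  by rewrite /P coefB coef_poly jq coefZ coefXn => /eqP; rewrite subr_eq0 => /eqP.
split; first by rewrite Pc // eqxx mulr1.
by move=> j jq; rewrite Pc ?ltn_eqF ?mulr0 // ltnW.
Qed.

End Coefficients.

(** * Asymptotic expansion of Irwin sums *)

Section Final.
Variable R : realType.
Local Notation G := (normalized_excess R).
Local Notation bigO d := (bigOinv (R := R) d.+2).
Let b0 d : (0 < d.+2)%N. Proof. by []. Qed.

Lemma zeta2_gt0 : 0 < zeta (2 : R).
Proof.
apply: (lt_le_trans (ltr01 : (0 : R) < 1)).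
rewrite -(cvg_lim _ (@cvg_zeta R 0)) //; apply: limr_ge.
  by apply: cvgP; exact: cvg_zeta.
near=> X; have X1 : (1 < X)%N by near: X; exists 2%N.
rewrite (big_ltn X1) invr1 expr1n lerDl; apply: sumr_ge0 => n _.
by rewrite exprn_ge0 ?invr_ge0 ?ler0n.
Unshelve. all: by end_near. Qed.

Lemma eqO_of_le (f g h : nat -> R) (m : nat) (C : R) :
  (forall b, (m <= b)%N -> `|f b - g b| <= C * `|h b|) -> f = g +O_\oo h.
Proof.
move=> fg; apply/eqaddOP; near=> D; near=> b.
have bm : (m <= b)%N by near: b; exists m.
apply: le_trans (fg b bm) _; rewrite ler_wpM2r //.
Unshelve. all: by end_near. Qed.

(** Multiplication by b turns O(b^-(N+1)) into O(b^-N). *)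
Lemma eqO_scaled d N (e f g h : nat -> R) : bigO d N.+1 e ->
  (forall b, (d.+2 <= b)%N -> f b - g b = b%:R * e b) ->
  (forall b, (d.+2 <= b)%N -> h b = b%:R^-1 ^+ N) -> f = g +O_\oo h.
Proof.
move=> [C eC] fg hE; apply: (@eqO_of_le _ _ _ d.+2 C) => b bb.
have bR : (0 : R) < b%:R by rewrite ltr0n (leq_trans (b0 d) bb).
have bN0 : (b%:R : R) != 0 by rewrite gt_eqF.
rewrite fg // hE // normrM normrX normfV (gtr0_norm bR) -ler_pdivlMl // mulrCA.
by rewrite -exprS; exact: eC.
Qed.

Lemma leading_term0 k : bigO 0 (2 * k + 3) (fun b => G 0 k b -
    zeta 2 / 2 * b%:R^-1 ^+ (2 * k + 2)).
Proof.
case: k => [|k].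
  have e1 := bigOinvW (b0 0) (isT : (3 <= 4)%N) (normalized_excess00_asymp R).
  apply: eq_bigOinv (bigOinvB e1 (bigOinvZ (zeta 3 / 3) (bigOinv_pow R 2 3))) => b _.
  by ring.
have le : (2 * k.+1 + 3 <= 2 * k + 6)%N by lia.
have e1 := bigOinvW (b0 0) le (normalized_excess0S_asymp R k).
have e2 := bigOinvZ (k.+1%:R * zeta 2 / 2) (bigOinv_pow R 2 (2 * k.+1 + 3)).
apply: eq_bigOinv (bigOinvD e1 e2) => b _.
rewrite (_ : (2 * k.+1 + 3 = 2 * k + 5)%N); last by lia.
by rewrite (_ : (2 * k.+1 + 2 = 2 * k + 4)%N); [ring|lia].
Qed.

Lemma leading_term_d0 d : (0 < d)%N -> bigO d 1 (fun b => G d 0 b -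
    - ln (1 + 1 / d%:R) * b%:R^-1 ^+ 0).
Proof.
move=> d0; have e1 := bigOinvW (b0 d) (isT : (1 <= 4)%N) (normalized_excess_d0_asymp R d0).
have e2 := bigOinvW (b0 d) (isT : (1 <= 2)%N) (bigOinvZ
  ((d%:R + 1 / 2) * (zeta 2 - d%:R ^- 2)) (bigOinv_pow R d.+2 2)).
have e3 := bigOinvW (b0 d) (isT : (1 <= 3)%N) (bigOinvZ
  ((d%:R ^+ 2 + d%:R + 1 / 3) * zeta 3
      - (9 * d%:R ^+ 2 + 8 * d%:R + 2) / (6 * d%:R ^+ 3 * (d%:R + 1)))
  (bigOinv_pow R d.+2 3)).
apply: eq_bigOinv (bigOinvB (bigOinvD e1 e2) e3) => b _.
by rewrite expr0 mulr1; ring.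
Qed.

Lemma leading_term_dS d k : (0 < d)%N -> bigO d (2 * k + 3) (fun b => G d k.+1 b -
    (d%:R + 1 / 2) / d%:R ^+ 2 * b%:R^-1 ^+ (2 * k + 2)).
Proof.
move=> d0; case: k => [|k].
  have e1 := bigOinvW (b0 d) (isT : (3 <= 4)%N) (normalized_excess_d1_asymp R d0).
  have e2 := bigOinvZ ((9 * d%:R ^+ 2 + 8 * d%:R + 2) / (6 * d%:R ^+ 3 * (d%:R + 1)))
    (bigOinv_pow R d.+2 3).
  apply: eq_bigOinv (bigOinvB e1 e2) => b _.
  by rewrite muln0 add0n; ring.
have le : (2 * k.+1 + 3 <= 2 * k + 6)%N by lia.
have e1 := bigOinvW (b0 d) le (normalized_excess_dSS_asymp R d0 k).
have e2 := bigOinvZ ((d%:R + 1 / 2) * (k%:R * d%:R + k%:R - 1) /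
  (d%:R ^+ 2 * (d%:R + 1))) (bigOinv_pow R d.+2 (2 * k.+1 + 3)).
apply: eq_bigOinv (bigOinvD e1 e2) => b _.
rewrite (_ : (2 * k.+1 + 3 = 2 * k + 5)%N); last by lia.
by rewrite (_ : (2 * k.+1 + 2 = 2 * k + 4)%N); [ring|lia].
Qed.

(** The leading term g b^-q of [normalized_excess], corresponding to the power
    b^-(q - 1) of the Irwin sum. *)
Lemma leading_term d k :
  exists q g, [/\ q%:Z - 1 = (if d == 0%N then 2 * k%:Z + 1 else 2 * k%:Z - 1) :> int,
    g != 0, bigO d q.+1 (fun b => G d k b - g * b%:R^-1 ^+ q) &
    (0 < d)%N -> k = 0%N -> q = 0%N /\ g = - ln (1 + 1 / d%:R)].
Proof.
case: (posnP d) => [->|d0].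
  exists (2 * k + 2)%N, (zeta 2 / 2); split => //; first by lia.
    by rewrite mulf_neq0 ?invr_neq0 // gt_eqF // zeta2_gt0.
  by rewrite -addnS; exact: leading_term0.
have dR : (0 : R) < d%:R by rewrite ltr0n.
case: k => [|k].
  exists 0%N, (- ln (1 + 1 / d%:R)); split => //; last exact: leading_term_d0.
  by rewrite oppr_eq0 gt_eqF // ln_gt0 // ltrDl mul1r invr_gt0.
exists (2 * k + 2)%N, ((d%:R + 1 / 2) / d%:R ^+ 2); split => //; first by lia.
  have n1 : (d%:R + 1 / 2 : R) != 0 by rewrite gt_eqF // addr_gt0 // divr_gt0.
  by rewrite mulf_neq0 // invr_neq0 // expf_neq0 // gt_eqF.
by rewrite -addnS; exact: leading_term_dS.
Qed.

Lemma irwin_sum_normalized d k b : (d.+2 <= b)%N ->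
  irwin_sum R b d k = b%:R * ln b%:R + b%:R * G d k b.
Proof.
move=> bb; have bN0 : (b%:R : R) != 0 by rewrite pnatr_eq0 -lt0n (leq_trans (b0 d) bb).
rewrite /normalized_excess; field; exact: bN0.
Qed.

Lemma irwin_sum_asymp d k N (F g : nat -> R) :
  bigO d N.+1 (fun b => G d k b - g b) ->
  (forall b, (d.+2 <= b)%N -> (b%:R : R) != 0 ->
     F b = b%:R * ln b%:R + b%:R * g b) ->
  (fun b => irwin_sum R b d k) = F +O_\oo (fun b => b%:R ^- N : R).
Proof.
move=> gO FE; apply: (eqO_scaled gO) => b bb; last by rewrite exprVn.
have bN0 : (b%:R : R) != 0 by rewrite pnatr_eq0 -lt0n (leq_trans (b0 d) bb).
by rewrite irwin_sum_normalized // FE //; ring.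
Qed.

Lemma irwin_sum_expansion d k : exists (n0 : int) (a : int -> R),
     [/\ asymptotic_expansion
           (fun b : nat => irwin_sum R b d k - b%:R * ln b%:R) n0 a,
         first_exponent n0 a
           (if d == 0%N then 2 * k%:Z + 1 else 2 * k%:Z - 1)
       & (0 < d)%N -> k = 0%N -> a (-1) = - ln (1 + 1 / d%:R)].
Proof.
have [c cE] := expandable_coefficients (b0 d) (normalized_excess_expandable R d k).
have [q [g [qE g0 gO dk]]] := leading_term d k.
have [cq cl] := leading_coefficients (b0 d) cE gO.
(* The expansion of b times [normalized_excess] starts at b^1: its
   coefficients are those of [normalized_excess], with indices shifted by 1. *)
exists (-1), (fun n : int => c (absz (n + 1 : int)%R)); split.
- move=> N N1; pose M := absz (N - -1 : int)%R.
  have NE : N = M%:Z - 1 by rewrite /M; lia.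
  apply: (eqO_scaled (cE M.+1)) => b bb; last first.
    rewrite NE (_ : - (M%:Z - 1) - 1 = - M%:Z); last by lia.
    by rewrite -exprnN exprVn.
  have bN0 : (b%:R : R) != 0 by rewrite pnatr_eq0 -lt0n (leq_trans (b0 d) bb).
  rewrite irwin_sum_normalized // [RHS]mulrBr -/M big_mkord mulr_sumr.
  rewrite [X in X - _ = _](_ : _ = b%:R * G d k b); last by ring.
  congr (_ - _); apply: eq_bigr => j _.
  rewrite addrAC addNr add0r absz_nat opprD opprK.
  rewrite expfzDr // expr1z mulrCA; congr (_ * (_ * _)).
  by rewrite exprVn -exprnN.
- rewrite -qE; split; first by lia.
    by rewrite subrK absz_nat cq.
  by move=> n n1 nq; rewrite cl //; lia.
move=> d0 k0; have [q0 <-] := dk d0 k0.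
by rewrite addNr absz0 -cq q0.
Qed.

End Final.

Theorem theorem1 (R : realType) (d k : nat) :
  (exists (n0 : int) (a : int -> R),
     [/\ asymptotic_expansion
           (fun b : nat => irwin_sum R b d k - b%:R * ln b%:R) n0 a,
         first_exponent n0 a
           (if d == 0%N then 2 * k%:Z + 1 else 2 * k%:Z - 1)
       & (0 < d)%N -> k = 0%N -> a (-1) = - ln (1 + 1 / d%:R)])
  /\
  [/\ (fun b : nat => irwin_sum R b 0 0) =
        (fun b : nat => b%:R * ln b%:R + zeta 2 / (2 * b%:R)
                        - zeta 3 / (3 * b%:R ^+ 2))
        +O_\oo (fun b : nat => b%:R ^- 3 : R),
      (0 < k)%N ->
      (fun b : nat => irwin_sum R b 0 k) =
        (fun b : nat => b%:R * ln b%:R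
                        + zeta 2 / (2 * b%:R ^+ (2 * k + 1))
                        + k%:R * zeta 2 / (2 * b%:R ^+ (2 * k + 2)))
        +O_\oo (fun b : nat => b%:R ^- (2 * k + 3) : R),
      (0 < d)%N ->
      (fun b : nat => irwin_sum R b d 0) =
        (fun b : nat => b%:R * ln b%:R - b%:R * ln (1 + 1 / d%:R)
           + (d%:R + 1 / 2) * (zeta 2 - d%:R ^- 2) / b%:R
           - ((d%:R ^+ 2 + d%:R + 1 / 3) * zeta 3
              - (9 * d%:R ^+ 2 + 8 * d%:R + 2)
                / (6 * d%:R ^+ 3 * (d%:R + 1))) / b%:R ^+ 2)
        +O_\oo (fun b : nat => b%:R ^- 3 : R),
      (0 < d)%N ->
      (fun b : nat => irwin_sum R b d 1) =
        (fun b : nat => b%:R * ln b%:R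
           + (d%:R + 1 / 2) / (d%:R ^+ 2 * b%:R)
           - (9 * d%:R ^+ 2 + 8 * d%:R + 2)
             / (6 * d%:R ^+ 3 * (d%:R + 1) * b%:R ^+ 2))
        +O_\oo (fun b : nat => b%:R ^- 3 : R)
    & (0 < d)%N -> (1 < k)%N ->
      (fun b : nat => irwin_sum R b d k) =
        (fun b : nat => b%:R * ln b%:R
           + (d%:R + 1 / 2) / (d%:R ^+ 2 * b%:R ^+ (2 * k - 1))
           + (d%:R + 1 / 2) * ((k%:R - 2) * d%:R + k%:R - 3)
             / (d%:R ^+ 2 * (d%:R + 1) * b%:R ^+ (2 * k)))
        +O_\oo (fun b : nat => b%:R ^- (2 * k + 1) : R)].
Proof.
have dN0 : (0 < d)%N -> (d%:R : R) != 0 by move=> d0; rewrite pnatr_eq0 -lt0n.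
have d1N0 : (d%:R + 1 : R) != 0 by rewrite natr1 pnatr_eq0.
split; first exact: irwin_sum_expansion.
split.
- apply: (irwin_sum_asymp (normalized_excess00_asymp R)) => b _ bN0; field; exact: bN0.
- case: k => [//|k] _.
  rewrite (_ : (2 * k.+1 + 3 = 2 * k + 5)%N); last by lia.
  apply: irwin_sum_asymp (_ : bigOinv _ (2 * k + 5).+1 _) _.
    by rewrite -addnS; exact: normalized_excess0S_asymp.
  move=> b _ bN0.
  rewrite (_ : (2 * k.+1 + 1 = 2 * k + 3)%N); last by lia.
  rewrite (_ : (2 * k.+1 + 2 = (2 * k + 3).+1)%N); last by lia.
  rewrite (_ : (2 * k + 5 = (2 * k + 3).+2)%N); last by lia.
  rewrite (_ : (2 * k + 4 = (2 * k + 3).+1)%N); last by lia.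
  rewrite !exprVn ![_ ^+ _.+1]exprS.
  have := expf_neq0 (2 * k + 3) bN0; move: (_ ^+ (2 * k + 3)) => B BN0.
  by field; rewrite BN0 bN0.
- move=> d0; apply: (irwin_sum_asymp (normalized_excess_d0_asymp R d0)) => b _ bN0.
  by field; rewrite bN0 d1N0 dN0.
- move=> d0; apply: (irwin_sum_asymp (normalized_excess_d1_asymp R d0)) => b _ bN0.
  by field; rewrite bN0 d1N0 dN0.
move=> d0; case: k => [//|[//|k]] _.
rewrite (_ : (2 * k.+2 + 1 = 2 * k + 5)%N); last by lia.
apply: irwin_sum_asymp (_ : bigOinv _ (2 * k + 5).+1 _) _.
  by rewrite -addnS; exact: normalized_excess_dSS_asymp.
move=> b _ bN0.
rewrite (_ : (2 * k.+2 - 1 = 2 * k + 3)%N); last by lia.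
rewrite (_ : (2 * k.+2 = (2 * k + 3).+1)%N); last by lia.
rewrite (_ : (2 * k + 5 = (2 * k + 3).+2)%N); last by lia.
rewrite (_ : (2 * k + 4 = (2 * k + 3).+1)%N); last by lia.
rewrite !exprVn ![_ ^+ _.+1]exprS -!natr1.
have := expf_neq0 (2 * k + 3) bN0; move: (_ ^+ (2 * k + 3)) => B BN0.
by field; rewrite BN0 bN0 d1N0 dN0.
Qed.
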